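(* Let $\eta\in\{i,j,k\}$ and let $A=A_0+A_1\epsilon\in\mathbb{DQ}^{n\times n}$ and $B=B_0+B_1\epsilon\in\mathbb{DQ}^{n\times n}$ be given with $B^{\eta^*}=B$. Denote $$ \begin{array}{l} B_{11}=B_1-A_1\big(A_0^{\dagger}B_0+L_{A_0}B_0(A_0^{\eta^*})^{\dagger}\big),\quad D_{11}=B_1-\big(A_0^{\dagger}B_0+L_{A_0}B_0(A_0^{\eta^*})^{\dagger}\big)A_1^{\eta^*},\\ A_{11}=A_1L_{A_0},\quad A_2=R_{A_0}A_{11},\quad B_2=R_{A_0^{\eta^*}},\quad C_2=R_{A_0}B_{11},\quad C_3=D_{11}L_{A_0^{\eta^*}},\\ A_{00}=B_2^{\eta^*}L_{A_2},\quad B_{00}=R_{B_2}A_2^{\eta^*},\quad C_{00}=C_3-B_2^{\eta^*}A_2^{\dagger}C_2B_2^{\dagger}A_2^{\eta^*},\quad D_{00}=R_{A_{00}}B_2^{\eta^*},\\ \Phi=A_2^{\dagger}C_2B_2^{\dagger}+L_{A_2}A_{00}^{\dagger}C_{00}(A_2^{\eta^*})^{\dagger}-L_{A_2}A_{00}^{\dagger}B_2^{\eta^*} D_{00}^{\dagger}R_{A_{00}}C_{00}(A_2^{\eta^*})^{\dagger}+D_{00}^{\dagger}R_{A_{00}}C_{00}B_{00}^{\dagger}R_{B_2}. \end{array} $$ Then the following statements are equivalent: (1) The dual quaternion matrix equation $AX=B$ has an $\eta$-Hermitian solution $X\in\mathbb{DQ}^{n\times n}$. (2) All of the following hold: $$A_0B_0=B_0A_0^{\eta^*},\quad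 A_0B_1-B_0A_1^{\eta^*}=B_1A_0^{\eta^*}-A_1B_0,$$ $$R_{A_0}B_0=0,\quad R_{A_2}C_2=0,\quad R_{B_2^{\eta^*}}C_3=0,\quad R_{A_{00}}C_{00}L_{B_{00}}=0.$$ (3) $A_0B_0=B_0A_0^{\eta^*}$ and $A_0B_1-B_0A_1^{\eta^*}=B_1A_0^{\eta^*}-A_1B_0$ hold, and $$r\begin{bmatrix}A_0&B_0\end{bmatrix}=r(A_0),$$ $$r\begin{bmatrix}A_0&B_1&A_1 \\ 0&B_0&A_0\end{bmatrix}=r\begin{bmatrix}A_0&A_1 \\ 0&A_0\end{bmatrix},\qquad r\begin{bmatrix}A_0&A_1B_0-B_1A_0^{\eta^*}\end{bmatrix}=r(A_0),$$ $$r\begin{bmatrix}B_1A_1^{\eta^*}-A_1B_1&A_0&B_1A_0^{\eta^*}-A_1B_0 \\ A_0^{\eta^*}&0&0 \\ B_0A_1^{\eta^*}-A_0B_1&0&0\end{bmatrix}=r(A_0)+r(A_0^{\eta^*})=2r(A_0).$$ In this case, the general $\eta$-Hermitian solution of $AX=B$ can be expressed as $X=X_0+X_1\epsilon$, where $$X_0=\frac{\widetilde{X_0}+\widetilde{X_0}^{\eta^*}}{2},\qquad X_1=\frac{\widetilde{X_1}+\widetilde{X_1}^{\eta^*}}{2},$$ and $$\widetilde{X_0}=A_0^{\dagger}B_0+L_{A_0}B_0(A_0^{\eta^*})^{\dagger}+L_{A_0}UR_{A_0^{\eta^*}},$$ $$\widetilde{X_1}=A_0^{\dagger}(B_{11}-A_{11}UR_{A_0^{\eta^*}})+L_{A_0}(D_{11}-L_{A_0}UA_{11}^{\eta^*})(A_0^{\eta^*})^{\dagger}+L_{A_0}U_1R_{A_0^{\eta^*}},$$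 $$U=\Phi+L_{A_2}L_{A_{00}}U_2+U_3R_{B_{00}}R_{B_2}+L_{A_2}U_4R_{A_2^{\eta^*}}+L_{B_2^{\eta^*}}U_5R_{B_2},$$ with $U_1,U_2,U_3,U_4,U_5$ arbitrary matrices over $\mathbb{H}$ of appropriate sizes.
   Context: $\mathbb{H}$ denotes the real quaternions with imaginary units $i,j,k$. The dual quaternions are $\mathbb{DQ}=\{c_0+c_1\epsilon: c_0,c_1\in\mathbb{H}\}$, where $\epsilon^2=0$ and $\epsilon$ commutes with quaternions; addition and multiplication are the resulting ones, e.g. $(a_0+a_1\epsilon)(b_0+b_1\epsilon)=a_0b_0+(a_0b_1+a_1b_0)\epsilon$. A dual quaternion matrix $A\in\mathbb{DQ}^{m\times n}$ is written uniquely as $A=A_0+A_1\epsilon$ with $A_0,A_1\in\mathbb{H}^{m\times n}$, and two such matrices are equal iff their two parts are equal. For a quaternion matrix $M$: $r(M)$ is its rank; $M^*$ its conjugate transpose; $M^\dagger$ its Moore-Penrose inverse, i.e. the unique $X$ with $MXM=M$, $XMX=X$, $(MX)^*=MX$, $(XM)^*=XM$; $L_M=I-M^\dagger M$, $R_M=I-MM^\dagger$; and, for $\eta\in\{i,j,k\}$, $M^{\eta^*}=-\eta M^*\eta$. For a dual quaternion matrix $A=A_0+A_1\epsilon$, $A^*=A_0^*+A_1^*\epsilon$ and $A^{\eta^*}=-\eta A^*\eta=A_0^{\eta^*}+A_1^{\eta^*}\epsilon$; a square dual quaternion matrix $A$ is called $\eta$-Hermitian if $A=A^{\eta^*}$.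 ''The general $\eta$-Hermitian solution can be expressed as'' means that the $\eta$-Hermitian solutions are exactly the matrices given by the formula as the arbitrary parameter matrices vary. *)

(* Defs.v *)
From HB Require Import structures.
From mathcomp Require Import all_boot all_order all_algebra.
From mathcomp Require Import ring.
From mathcomp Require Import boolp classical_sets reals.

Set Implicit Arguments.
Unset Strict Implicit.
Unset Printing Implicit Defensive.

Import Order.TTheory GRing.Theory Num.Theory.
Local Open Scope ring_scope.

Record quat (R : realType) := Quat { q_re : R; q_i : R; q_j : R; q_k : R }.

Section QuaternionRing.
Variable R : realType.
Implicit Types p q r : quat R.

Definition quat_to_prod q := (q_re q, q_i q, q_j q, q_k q).
Definition prod_to_quat (x : R * R * R * R) :=
  Quat x.1.1.1 x.1.1.2 x.1.2 x.2.
Lemma quat_to_prodK : cancel quat_to_prod prod_to_quat. Proof. by case. Qed.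

HB.instance Definition _ := Choice.copy (quat R) (can_type quat_to_prodK).

Definition quat_zero : quat R := Quat 0 0 0 0.
Definition quat_one : quat R := Quat 1 0 0 0.
Definition quatI : quat R := Quat 0 1 0 0.
Definition quatJ : quat R := Quat 0 0 1 0.
Definition quatK : quat R := Quat 0 0 0 1.

Definition quat_opp q := Quat (- q_re q) (- q_i q) (- q_j q) (- q_k q).
Definition quat_add p q :=
  Quat (q_re p + q_re q) (q_i p + q_i q) (q_j p + q_j q) (q_k p + q_k q).
Definition quat_mul p q :=
  Quat (q_re p * q_re q - q_i p * q_i q - q_j p * q_j q - q_k p * q_k q)
       (q_re p * q_i q + q_i p * q_re q + q_j p * q_k q - q_k p * q_j q)
       (q_re p * q_j q - q_i p * q_k q + q_j p * q_re q + q_k p * q_i q)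
       (q_re p * q_k q + q_i p * q_j q - q_j p * q_i q + q_k p * q_re q).

Definition quat_conj q := Quat (q_re q) (- q_i q) (- q_j q) (- q_k q).
Definition quat_normsq q := q_re q ^+ 2 + q_i q ^+ 2 + q_j q ^+ 2 + q_k q ^+ 2.
Definition quat_inv q :=
  let d := quat_normsq q in
  Quat (q_re q / d) (- q_i q / d) (- q_j q / d) (- q_k q / d).

Fact quat_addA : associative quat_add.
Proof. by move=> [????] [????] [????]; congr Quat; rewrite /= addrA. Qed.
Fact quat_addC : commutative quat_add.
Proof. by move=> [????] [????]; congr Quat; rewrite /= addrC. Qed.
Fact quat_add0 : left_id quat_zero quat_add.
Proof. by move=> [????]; congr Quat; rewrite /= add0r. Qed.
Fact quat_addN : left_inverse quat_zero quat_opp quat_add.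
Proof. by move=> [????]; congr Quat; rewrite /= addNr. Qed.

HB.instance Definition _ :=
  GRing.isZmodule.Build (quat R) quat_addA quat_addC quat_add0 quat_addN.

Fact quat_mulA : associative quat_mul.
Proof. by move=> [????] [????] [????]; congr Quat => /=; ring. Qed.
Fact quat_mul1l : left_id quat_one quat_mul.
Proof. by move=> [????]; rewrite /quat_mul /=; congr Quat; ring. Qed.
Fact quat_mul1r : right_id quat_one quat_mul.
Proof. by move=> [????]; rewrite /quat_mul /=; congr Quat; ring. Qed.
Fact quat_mulDl : left_distributive quat_mul +%R.
Proof. by move=> [????] [????] [????]; congr Quat => /=; ring. Qed.
Fact quat_mulDr : right_distributive quat_mul +%R.
Proof. by move=> [????] [????] [????]; congr Quat => /=; ring. Qed.
Fact quat_oner_neq0 : quat_one != 0.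
Proof. by apply/eqP => -[/eqP]; rewrite oner_eq0. Qed.

HB.instance Definition _ := GRing.Zmodule_isNzRing.Build (quat R)
  quat_mulA quat_mul1l quat_mul1r quat_mulDl quat_mulDr quat_oner_neq0.

Lemma quat_normsq_eq0 q : (quat_normsq q == 0) = (q == 0).
Proof.
apply/idP/eqP => [|->]; last by rewrite /quat_normsq /= !expr0n /= !addr0.
case: q => a b c d; rewrite /quat_normsq /=.
rewrite !paddr_eq0 ?addr_ge0 ?sqr_ge0 // !sqrf_eq0.
by move=> /andP[/andP[/andP[/eqP-> /eqP->] /eqP->] /eqP->].
Qed.

Fact quat_mulVr : {in [pred q | q != 0], left_inverse 1 quat_inv *%R}.
Proof.
move=> q; rewrite inE -quat_normsq_eq0; case: q => a b c d.
rewrite /quat_normsq /= => n0.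
rewrite -[RHS]/quat_one /quat_one.
by congr Quat; rewrite /= /quat_normsq /=; field.
Qed.
Fact quat_divrr : {in [pred q | q != 0], right_inverse 1 quat_inv *%R}.
Proof.
move=> q; rewrite inE -quat_normsq_eq0; case: q => a b c d.
rewrite /quat_normsq /= => n0.
rewrite -[RHS]/quat_one /quat_one.
by congr Quat; rewrite /= /quat_normsq /=; field.
Qed.
Fact quat_unitP p q : q * p = 1 /\ p * q = 1 -> p \in [pred q | q != 0].
Proof.
case=> pq _; rewrite inE; apply/eqP => p0; move: pq.
by rewrite p0 mulr0 => /esym/eqP; rewrite oner_eq0.
Qed.
Fact quat_inv_out : {in [predC [pred q | q != 0]], quat_inv =1 id}.
Proof.
move=> q; rewrite !inE negbK => /eqP ->.
by congr Quat; rewrite /= ?oppr0 mul0r.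
Qed.

HB.instance Definition _ := GRing.NzRing_hasMulInverse.Build (quat R)
  quat_mulVr quat_divrr quat_unitP quat_inv_out.

End QuaternionRing.

Record dual (K : nzRingType) := Dual { d_std : K; d_inf : K }.

Section DualRing.
Variable K : nzRingType.
Implicit Types x y z : dual K.

Definition dual_to_prod x := (d_std x, d_inf x).
Definition prod_to_dual (x : K * K) := Dual x.1 x.2.
Lemma dual_to_prodK : cancel dual_to_prod prod_to_dual. Proof. by case. Qed.

HB.instance Definition _ := Choice.copy (dual K) (can_type dual_to_prodK).

Definition dual_zero : dual K := Dual 0 0.
Definition dual_one : dual K := Dual 1 0.
Definition dual_opp x := Dual (- d_std x) (- d_inf x).
Definition dual_add x y := Dual (d_std x + d_std y) (d_inf x + d_inf y).
Definition dual_mul x y :=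
  Dual (d_std x * d_std y) (d_std x * d_inf y + d_inf x * d_std y).

Fact dual_addA : associative dual_add.
Proof. by move=> [??] [??] [??]; congr Dual; rewrite /= addrA. Qed.
Fact dual_addC : commutative dual_add.
Proof. by move=> [??] [??]; congr Dual; rewrite /= addrC. Qed.
Fact dual_add0 : left_id dual_zero dual_add.
Proof. by move=> [??]; congr Dual; rewrite /= add0r. Qed.
Fact dual_addN : left_inverse dual_zero dual_opp dual_add.
Proof. by move=> [??]; congr Dual; rewrite /= addNr. Qed.

HB.instance Definition _ :=
  GRing.isZmodule.Build (dual K) dual_addA dual_addC dual_add0 dual_addN.

Fact dual_mulA : associative dual_mul.
Proof.
move=> [??] [??] [??]; congr Dual; rewrite /= ?mulrA //.
by rewrite mulrDr mulrDl !mulrA addrA.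
Qed.
Fact dual_mul1l : left_id dual_one dual_mul.
Proof.
by move=> [??]; rewrite /dual_mul /= !mul1r mul0r addr0.
Qed.
Fact dual_mul1r : right_id dual_one dual_mul.
Proof.
by move=> [??]; rewrite /dual_mul /= !mulr1 mulr0 add0r.
Qed.
Fact dual_mulDl : left_distributive dual_mul +%R.
Proof.
by move=> [??] [??] [??]; congr Dual; rewrite /= !mulrDl // addrACA.
Qed.
Fact dual_mulDr : right_distributive dual_mul +%R.
Proof.
by move=> [??] [??] [??]; congr Dual; rewrite /= !mulrDr // addrACA.
Qed.
Fact dual_oner_neq0 : dual_one != 0.
Proof. by apply/eqP => -[/eqP]; rewrite oner_eq0. Qed.

HB.instance Definition _ := GRing.Zmodule_isNzRing.Build (dual K)
  dual_mulA dual_mul1l dual_mul1r dual_mulDl dual_mulDr dual_oner_neq0.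

End DualRing.

Notation dquat R := (dual (quat R)).

Section QuaternionMatrices.
Variable R : realType.

Definition qadj m n (M : 'M[quat R]_(m, n)) : 'M[quat R]_(n, m) :=
  map_mx (@quat_conj R) M^T.

Definition etaadj (eta : quat R) m n (M : 'M[quat R]_(m, n)) :
    'M[quat R]_(n, m) :=
  - (eta%:M *m qadj M *m eta%:M).

Definition is_mpinv m n (M : 'M[quat R]_(m, n)) (X : 'M[quat R]_(n, m)) :=
  [/\ M *m X *m M = M, X *m M *m X = X,
      qadj (M *m X) = M *m X & qadj (X *m M) = X *m M].

(* The default value 0 plays no role: by Penrose's theorem, which holds over
   the quaternions, exactly one X satisfies is_mpinv M. *)
Definition mpinv m n (M : 'M[quat R]_(m, n)) : 'M[quat R]_(n, m) :=
  xget 0 [set X | is_mpinv M X]%classic.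

Definition Lproj m n (M : 'M[quat R]_(m, n)) : 'M[quat R]_n :=
  1%:M - mpinv M *m M.
Definition Rproj m n (M : 'M[quat R]_(m, n)) : 'M[quat R]_m :=
  1%:M - M *m mpinv M.

(* Coefficients multiply the columns of M on the right, which is the side on
   which the column space of a quaternion matrix is a vector space. *)
Definition col_indep m n (M : 'M[quat R]_(m, n)) (S : {set 'I_n}) :=
  forall c : 'cV[quat R]_n,
    (forall j, j \notin S -> c j 0 = 0) -> M *m c = 0 -> c = 0.

(* mxalgebra's \rank requires a commutative field. *)
Definition qrank m n (M : 'M[quat R]_(m, n)) : nat :=
  \max_(S : {set 'I_n} | `[< col_indep M S >]) #|S|.

End QuaternionMatrices.

Section DualQuaternionMatrices.
Variable R : realType.

Definition stdmx m n (A : 'M[dquat R]_(m, n)) : 'M[quat R]_(m, n) :=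
  map_mx (@d_std _) A.
Definition infmx m n (A : 'M[dquat R]_(m, n)) : 'M[quat R]_(m, n) :=
  map_mx (@d_inf _) A.

Definition dualmx m n (A0 A1 : 'M[quat R]_(m, n)) : 'M[dquat R]_(m, n) :=
  \matrix_(i, j) Dual (A0 i j) (A1 i j).

Lemma dualmxK m n (A : 'M[dquat R]_(m, n)) : dualmx (stdmx A) (infmx A) = A.
Proof. by apply/matrixP => i j; rewrite !mxE; case: (A i j). Qed.

(* (c0 + c1 eps)^* = c0^* + c1^* eps: only the quaternion parts are
   conjugated, the sign of eps is kept. *)
Definition dquat_conj (x : dquat R) : dquat R :=
  Dual (quat_conj (d_std x)) (quat_conj (d_inf x)).

Definition dqadj m n (A : 'M[dquat R]_(m, n)) : 'M[dquat R]_(n, m) :=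
  map_mx dquat_conj A^T.

Definition detaadj (eta : quat R) m n (A : 'M[dquat R]_(m, n)) :
    'M[dquat R]_(n, m) :=
  - ((Dual eta 0)%:M *m dqadj A *m (Dual eta 0)%:M).

Definition eta_hermitian (eta : quat R) n (A : 'M[dquat R]_n) :=
  A = detaadj eta A.

End DualQuaternionMatrices.

(* Main.v *)
Require Import Defs.
From mathcomp Require Import all_boot all_order all_algebra.
From mathcomp Require Import ring boolp reals.
From mathcomp Require classical_sets.

Set Implicit Arguments.
Unset Strict Implicit.
Unset Printing Implicit Defensive.

Import Order.TTheory GRing.Theory Num.Theory.
Local Open Scope ring_scope.

(** Write s(M) for the eta-adjoint of M. It is an involutive additive
    anti-automorphism of the quaternion matrices that commutes with
    Moore-Penrose inversion, so it exchanges the projections L_M and R_M.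
    Splitting A X = B into standard and infinitesimal parts gives
      A0 X0 = B0,   A0 X1 = B1 - A1 X0,
    and for an eta-Hermitian X the images of these equations under s hold as
    well: X0 s(A0) = B0 and X1 s(A0) = B1 - X0 s(A1). Conversely half the sum
    of a solution of the four equations and its image under s is an
    eta-Hermitian solution, because B is eta-Hermitian. Hence everything
    reduces to these two-sided equations.

    A pair A X = C, X B = D is consistent iff R_A C = 0, D L_B = 0 and
    A D = C B, and then X = A^+ C + L_A D B^+ + L_A U R_B with U free
    ([two_sided_solution], [two_sided_general]). Applied to X0, this leaves a
    parameter U; the pair for X1 is then consistent iff
    A2 U B2 = C2 and s(B2) U s(A2) = C3 ([two_sided_param]).

    In this last system B2 and s(B2) = L_A0 are Hermitian projections with
    A2 s(B2) = A2, so in terms of V = s(B2) U B2 it is once more a pair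
    A2 V = C2, V s(A2) = C3. With P = A2^+ A2 one computes
    A00 = s(B2) - P, D00 = P and B00 = 0: the long expression for Phi
    collapses to A2^+ C2 + (s(B2) - P) C3 s(A2)^+, and the condition
    R_A00 C00 L_B00 = 0 says A2 C3 = C2 s(A2) when R_A2 C2 = R_s(B2) C3 = 0
    ([projected_consistency], [projected_general]).

    For the rank conditions, the rank of M is the real part of the trace of
    the orthogonal projection M M^+ ([qrankE]). If the column space of N lies in
    that of M, then M M^+ - N N^+ is a projection Q, and
    tr Q = tr (Q^* Q) is a sum of squared norms. It vanishes only for Q = 0, so
    equal ranks mean equal column spaces ([trank_range_eq]). Row rank equals
    column rank because tr (X Y) and tr (Y X) have the same real part. The
    bordered matrix of the last rank condition is equivalent to
    [G A0; s(A0) 0] with G = R_A0 (B1 s(A1) - A1 B1) L_s(A0), whose rank is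
    r(A0) + r(s(A0)) + r(G) ([qrank_bordered]); and G = C2 s(A2) - A2 C3 once
    the commutation conditions and R_A0 B0 = 0 hold ([rank_bordered]). *)

(** * Conjugation, adjoints and the real trace *)

Section Conjugation.
Variable R : realType.
Implicit Types p q : quat R.

Lemma quat_conjD p q : quat_conj (p + q) = quat_conj p + quat_conj q.
Proof. by case: p => ? ? ? ?; case: q => ? ? ? ?; congr Quat; rewrite /= ?opprD. Qed.

Lemma quat_conjN p : quat_conj (- p) = - quat_conj p.
Proof. by case: p. Qed.

Lemma quat_conj0 : quat_conj 0 = 0 :> quat R.
Proof. by congr Quat; rewrite /= ?oppr0. Qed.

Lemma quat_conj1 : quat_conj 1 = 1 :> quat R.
Proof. by congr Quat; rewrite /= ?oppr0. Qed.

Lemma quat_conjK : involutive (@quat_conj R).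
Proof. by case=> a b c d; rewrite /quat_conj /= !opprK. Qed.

Lemma quat_conjM p q : quat_conj (p * q) = quat_conj q * quat_conj p.
Proof. by case: p => ? ? ? ?; case: q => ? ? ? ?; congr Quat => /=; ring. Qed.

Lemma quat_conj_sum (I : Type) (r : seq I) (P : pred I) (F : I -> quat R) :
  quat_conj (\sum_(i <- r | P i) F i) = \sum_(i <- r | P i) quat_conj (F i).
Proof. exact: (big_morph _ quat_conjD quat_conj0). Qed.

Lemma q_re_sum (I : Type) (r : seq I) (P : pred I) (F : I -> quat R) :
  q_re (\sum_(i <- r | P i) F i) = \sum_(i <- r | P i) q_re (F i).
Proof. exact: (big_morph (@q_re R) (fun _ _ => erefl) erefl). Qed.

Lemma q_reMC p q : q_re (p * q) = q_re (q * p).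
Proof. by case: p => ? ? ? ?; case: q => ? ? ? ? /=; ring. Qed.

Lemma q_re_conjM p : q_re (quat_conj p * p) = quat_normsq p.
Proof. by case: p => ? ? ? ?; rewrite /quat_normsq /=; ring. Qed.

Lemma quat_normsq_ge0 p : 0 <= quat_normsq p.
Proof. by rewrite /quat_normsq !addr_ge0 ?sqr_ge0. Qed.

Lemma quat_conjV p : p != 0 -> quat_conj p^-1 = (quat_conj p)^-1.
Proof.
move=> p0; have up : p \is a GRing.unit by [].
have e : quat_conj p^-1 * quat_conj p = 1.
  by rewrite -quat_conjM mulrV // quat_conj1.
have ucp : quat_conj p \is a GRing.unit.
  apply/eqP => cp0; move/eqP: p0; apply.
  by rewrite -[p]quat_conjK cp0 quat_conj0.
by rewrite -[LHS]mulr1 -(mulrV ucp) mulrA e mul1r.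
Qed.

End Conjugation.

Section Adjoint.
Variable R : realType.

Lemma qadjK m n (M : 'M[quat R]_(m, n)) : qadj (qadj M) = M.
Proof. by apply/matrixP => i j; rewrite !mxE quat_conjK. Qed.

Lemma qadjD m n (M N : 'M[quat R]_(m, n)) : qadj (M + N) = qadj M + qadj N.
Proof. by apply/matrixP => i j; rewrite !mxE quat_conjD. Qed.

Lemma qadjN m n (M : 'M[quat R]_(m, n)) : qadj (- M) = - qadj M.
Proof. by apply/matrixP => i j; rewrite !mxE quat_conjN. Qed.

Lemma qadjB m n (M N : 'M[quat R]_(m, n)) : qadj (M - N) = qadj M - qadj N.
Proof. by rewrite qadjD qadjN. Qed.

Lemma qadj0 m n : qadj (0 : 'M[quat R]_(m, n)) = 0.
Proof. by apply/matrixP => i j; rewrite !mxE quat_conj0. Qed.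

Lemma qadj_scalar n (a : quat R) : qadj (a%:M : 'M_n) = (quat_conj a)%:M.
Proof.
apply/matrixP => i j; rewrite !mxE eq_sym.
by case: eqP; rewrite ?mulr1n ?mulr0n ?quat_conj0.
Qed.

Lemma qadj1 n : qadj (1%:M : 'M[quat R]_n) = 1%:M.
Proof. by rewrite qadj_scalar quat_conj1. Qed.

Lemma qadjM m n p (M : 'M[quat R]_(m, n)) (N : 'M_(n, p)) :
  qadj (M *m N) = qadj N *m qadj M.
Proof.
apply/matrixP => i j; rewrite !mxE quat_conj_sum.
by apply: eq_bigr => k _; rewrite !mxE quat_conjM.
Qed.

Lemma qadj_block m1 m2 n1 n2 (a : 'M[quat R]_(m1, n1)) (b : 'M_(m1, n2))
    (c : 'M_(m2, n1)) (d : 'M_(m2, n2)) :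
  qadj (block_mx a b c d) = block_mx (qadj a) (qadj c) (qadj b) (qadj d).
Proof. by rewrite /qadj tr_block_mx map_block_mx. Qed.

(** Quaternions do not commute, so the trace itself is not invariant under
    cyclic permutation of the factors; its real part is ([retr_mulC]). *)
Definition retr n (M : 'M[quat R]_n) : R := q_re (\tr M).

Lemma retrD n (M N : 'M[quat R]_n) : retr (M + N) = retr M + retr N.
Proof. by rewrite /retr mxtraceD. Qed.

Lemma retrN n (M : 'M[quat R]_n) : retr (- M) = - retr M.
Proof. by rewrite /retr raddfN. Qed.

Lemma retr0 n : retr (0 : 'M[quat R]_n) = 0.
Proof. by rewrite /retr mxtrace0. Qed.

Lemma retr_mulC m n (M : 'M[quat R]_(m, n)) (N : 'M_(n, m)) :
  retr (M *m N) = retr (N *m M).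
Proof.
rewrite /retr /mxtrace !q_re_sum.
under eq_bigr do rewrite mxE q_re_sum.
under [RHS]eq_bigr do rewrite mxE q_re_sum.
by rewrite exchange_big; do 2![apply: eq_bigr => ? _]; rewrite q_reMC.
Qed.

Lemma retr_qadj n (M : 'M[quat R]_n) : retr (qadj M) = retr M.
Proof.
by rewrite /retr /mxtrace !q_re_sum; apply: eq_bigr => i _; rewrite !mxE.
Qed.

Lemma retr_block m n (a : 'M[quat R]_m) b c (d : 'M_n) :
  retr (block_mx a b c d) = retr a + retr d.
Proof. by rewrite /retr mxtrace_block. Qed.

Lemma retr_gram m n (M : 'M[quat R]_(m, n)) :
  retr (qadj M *m M) = \sum_j \sum_i quat_normsq (M i j).
Proof.
rewrite /retr /mxtrace q_re_sum; apply: eq_bigr => j _.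
by rewrite mxE q_re_sum; apply: eq_bigr => i _; rewrite !mxE q_re_conjM.
Qed.

Lemma retr_gram_ge0 m n (M : 'M[quat R]_(m, n)) : 0 <= retr (qadj M *m M).
Proof. by rewrite retr_gram; do 2!apply: sumr_ge0 => ? _; apply: quat_normsq_ge0. Qed.

Lemma retr_gram_eq0 m n (M : 'M[quat R]_(m, n)) :
  retr (qadj M *m M) = 0 -> M = 0.
Proof.
rewrite retr_gram => /psumr_eq0P h; apply/matrixP => i j; rewrite mxE.
apply/eqP; rewrite -quat_normsq_eq0; apply/eqP.
have /psumr_eq0P -> // : \sum_i quat_normsq (M i j) = 0.
  by apply: h => // k _; apply: sumr_ge0 => ? _; apply: quat_normsq_ge0.
by move=> ? _; apply: quat_normsq_ge0.
Qed.

End Adjoint.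

(** * Moore-Penrose inverses over the quaternions *)

Section MoorePenrose.
Variable R : realType.

(** Induction on the columns of A = [a B]. Let X work for B and let
    c = a - B X a be the component of a orthogonal to the columns of B. If c = 0
    a zero row completes X. Otherwise b = (c^* c)^-1 c^* satisfies b B = 0 and
    b a = 1, and [b; X - X a b] works because its product with A is the
    Hermitian matrix B X + c b. *)
Lemma inverse13_exists m n (A : 'M[quat R]_(m, n)) :
  exists2 X, A *m X *m A = A & qadj (A *m X) = A *m X.
Proof.
elim: n A => [|n IHn] A.
  by exists 0; [apply/matrixP => i [] | rewrite mulmx0 qadj0].
move: A; rewrite -[n.+1]/(1 + n)%N => A; rewrite -[A]hsubmxK.
set a := lsubmx _; set B := rsubmx _.
have [X BXB hBX] := IHn B.
have [c defc] : exists c, c = a - B *m X *m a by exists (a - B *m X *m a).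
have [c0|c_neq0] := eqVneq c 0.
  have ea : B *m X *m a = a by apply/esym/eqP; rewrite -subr_eq0 -defc c0.
  exists (col_mx 0 X); rewrite !mul_row_col !mulmx0 !add0r //.
  by rewrite mul_mx_row ea BXB.
pose t := (qadj c *m c) 0 0.
have et : qadj c *m c = t%:M by apply: mx11_scalar.
have t0 : t != 0.
  apply: contra_neq c_neq0 => t0; apply: retr_gram_eq0.
  by rewrite et t0 raddf0 retr0.
(* t is real, which makes c t^-1 c^* Hermitian. *)
have tc : quat_conj t = t.
  have /matrixP/(_ 0 0) : qadj (qadj c *m c) = qadj c *m c by rewrite qadjM qadjK.
  by rewrite et qadj_scalar !mxE.
have idem : B *m X *m (B *m X) = B *m X by rewrite mulmxA BXB.
have ec : qadj c = qadj a *m (1%:M - B *m X).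
  by rewrite defc qadjB qadjM hBX mulmxBr mulmx1.
have [b [bB ba hcb]] : exists b : 'rV_m,
    [/\ b *m B = 0, b *m a = 1%:M & qadj (c *m b) = c *m b].
  exists (t^-1%:M *m qadj c); split.
  - by rewrite ec -!mulmxA mulmxBl mul1mx BXB subrr !mulmx0.
  - have cBX : qadj c *m (B *m X) = 0.
      by rewrite ec -mulmxA mulmxBl mul1mx idem subrr mulmx0.
    rewrite -mulmxA; suff -> : qadj c *m a = t%:M by rewrite -scalar_mxM mulVr.
    have da : a = c + B *m X *m a by rewrite defc subrK.
    by rewrite -et {1}da mulmxDr mulmxA cBX mul0mx addr0.
  - by rewrite !qadjM qadjK qadj_scalar quat_conjV // tc mulmxA.
have eAX : row_mx a B *m col_mx b (X - X *m a *m b) = B *m X + c *m b.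
  by rewrite mul_row_col mulmxBr defc mulmxBl !mulmxA addrCA addrA.
exists (col_mx b (X - X *m a *m b)); rewrite eAX; last by rewrite qadjD hBX hcb.
rewrite mul_mx_row !mulmxDl BXB -[c *m b *m a]mulmxA -[c *m b *m B]mulmxA ba bB.
by rewrite mulmx0 addr0 mulmx1 defc addrC subrK.
Qed.

(** If A X A = A = A Z A with A X and Z A Hermitian, then Z A X is the
    Moore-Penrose inverse of A; here Z is the adjoint of an inverse Y of A^*. *)
Lemma mpinv_exists m n (A : 'M[quat R]_(m, n)) : exists X, is_mpinv A X.
Proof.
have [X AXA hAX] := inverse13_exists A.
have [Y AYA hAY] := inverse13_exists (qadj A).
have {}AYA : A *m qadj Y *m A = A.
  by apply: (can_inj (@qadjK _ _ _)); rewrite !qadjM qadjK mulmxA.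
have {}hAY : qadj (qadj Y *m A) = qadj Y *m A by rewrite qadjM qadjK -hAY qadjM !qadjK.
have e1 : A *m (qadj Y *m A *m X) = A *m X by rewrite !mulmxA AYA.
have e2 : qadj Y *m A *m X *m A = qadj Y *m A by rewrite -!mulmxA (mulmxA A) AXA.
exists (qadj Y *m A *m X); split; rewrite ?e1 ?e2 ?AXA //.
by rewrite -!mulmxA (mulmxA A (qadj Y)) (mulmxA (A *m qadj Y)) AYA.
Qed.

Lemma is_mpinv_unique m n (A : 'M[quat R]_(m, n)) X Y :
  is_mpinv A X -> is_mpinv A Y -> X = Y.
Proof.
move=> [AXA XAX hAX hXA] [AYA YAY hAY hYA].
have eA : A *m X = A *m Y.
  by rewrite -{1}AYA -mulmxA -hAX -hAY -qadjM (mulmxA _ A) AXA.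
have eB : X *m A = Y *m A.
  by rewrite -{1}AYA -mulmxA mulmxA -hXA -hYA -qadjM -(mulmxA Y) (mulmxA A) AXA.
by rewrite -XAX eB -mulmxA eA mulmxA YAY.
Qed.

Lemma mpinvP m n (A : 'M[quat R]_(m, n)) : is_mpinv A (mpinv A).
Proof.
rewrite /mpinv; case: classical_sets.xgetP => [X -> //|h].
by have [X hX] := mpinv_exists A; case: (h X).
Qed.

Lemma mpinv_eq m n (A : 'M[quat R]_(m, n)) X : is_mpinv A X -> mpinv A = X.
Proof. exact/is_mpinv_unique/mpinvP. Qed.

Lemma mulmxKmp m n (A : 'M[quat R]_(m, n)) : A *m mpinv A *m A = A.
Proof. by case: (mpinvP A). Qed.

Lemma mpinvK2 m n (A : 'M[quat R]_(m, n)) : mpinv A *m A *m mpinv A = mpinv A.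
Proof. by case: (mpinvP A). Qed.

Lemma qadj_range m n (A : 'M[quat R]_(m, n)) : qadj (A *m mpinv A) = A *m mpinv A.
Proof. by case: (mpinvP A). Qed.

Lemma qadj_corange m n (A : 'M[quat R]_(m, n)) : qadj (mpinv A *m A) = mpinv A *m A.
Proof. by case: (mpinvP A). Qed.

Lemma mpinv_qadj m n (A : 'M[quat R]_(m, n)) : mpinv (qadj A) = qadj (mpinv A).
Proof.
apply: mpinv_eq; split; rewrite -!qadjM.
- by rewrite mulmxA mulmxKmp.
- by rewrite mulmxA mpinvK2.
- by rewrite !qadj_corange.
- by rewrite !qadj_range.
Qed.

Lemma mpinv0 m n : mpinv (0 : 'M[quat R]_(m, n)) = 0.
Proof. by apply: mpinv_eq; split; rewrite ?mulmx0 ?mul0mx ?qadj0. Qed.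

Lemma mpinv_proj n (Q : 'M[quat R]_n) : Q *m Q = Q -> qadj Q = Q -> mpinv Q = Q.
Proof. by move=> QQ hQ; apply: mpinv_eq; split; rewrite ?QQ. Qed.

(** The column space of A^+ is that of A^*, and Q fixes the latter because
    A^* = Q A^*. *)
Lemma mpinv_absorbl m n (A : 'M[quat R]_(m, n)) Q :
  qadj Q = Q -> A *m Q = A -> Q *m mpinv A = mpinv A.
Proof.
move=> hQ AQ; rewrite -{1}[mpinv A]mpinvK2 -qadj_corange qadjM !mulmxA -{1}hQ.
by rewrite -qadjM AQ -qadjM qadj_corange mpinvK2.
Qed.

Lemma mpinv_absorbr m n (A : 'M[quat R]_(m, n)) Q :
  qadj Q = Q -> Q *m A = A -> mpinv A *m Q = mpinv A.
Proof.
move=> hQ QA; rewrite -[LHS]qadjK qadjM hQ -mpinv_qadj mpinv_absorbl //.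
  by rewrite mpinv_qadj qadjK.
by rewrite -{1}hQ -qadjM QA.
Qed.

Lemma Rproj_mul m n (A : 'M[quat R]_(m, n)) : Rproj A *m A = 0.
Proof. by rewrite /Rproj mulmxBl mul1mx mulmxKmp subrr. Qed.

Lemma mul_Lproj m n (A : 'M[quat R]_(m, n)) : A *m Lproj A = 0.
Proof. by rewrite /Lproj mulmxBr mulmx1 mulmxA mulmxKmp subrr. Qed.

Lemma mpinv_Rproj m n (A : 'M[quat R]_(m, n)) : mpinv A *m Rproj A = 0.
Proof. by rewrite /Rproj mulmxBr mulmx1 mulmxA mpinvK2 subrr. Qed.

Lemma Lproj_mpinv m n (A : 'M[quat R]_(m, n)) : Lproj A *m mpinv A = 0.
Proof. by rewrite /Lproj mulmxBl mul1mx mpinvK2 subrr. Qed.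

Lemma Lproj_idem m n (A : 'M[quat R]_(m, n)) : Lproj A *m Lproj A = Lproj A.
Proof. by rewrite {1}/Lproj mulmxBl mul1mx -mulmxA mul_Lproj mulmx0 subr0. Qed.

Lemma Rproj_idem m n (A : 'M[quat R]_(m, n)) : Rproj A *m Rproj A = Rproj A.
Proof. by rewrite {2}/Rproj mulmxBr mulmx1 mulmxA Rproj_mul mul0mx subr0. Qed.

Lemma qadj_Lproj m n (A : 'M[quat R]_(m, n)) : qadj (Lproj A) = Lproj A.
Proof. by rewrite /Lproj qadjB qadj1 qadj_corange. Qed.

Lemma qadj_Rproj m n (A : 'M[quat R]_(m, n)) : qadj (Rproj A) = Rproj A.
Proof. by rewrite /Rproj qadjB qadj1 qadj_range. Qed.

Lemma Rproj_eq0P m n p (A : 'M[quat R]_(m, n)) (C : 'M_(m, p)) :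
  Rproj A *m C = 0 <-> A *m mpinv A *m C = C.
Proof.
rewrite /Rproj mulmxBl mul1mx; split=> [/eqP|->]; last by rewrite subrr.
by rewrite subr_eq0 eq_sym => /eqP.
Qed.

Lemma Lproj_eq0P m n p (A : 'M[quat R]_(m, n)) (D : 'M_(p, n)) :
  D *m Lproj A = 0 <-> D *m mpinv A *m A = D.
Proof.
rewrite /Lproj mulmxBr mulmx1 mulmxA; split=> [/eqP|->]; last by rewrite subrr.
by rewrite subr_eq0 eq_sym => /eqP.
Qed.

Lemma Rproj_range m n p (A : 'M[quat R]_(m, n)) (C : 'M_(m, p)) :
  Rproj A *m C = 0 <-> exists Y, C = A *m Y.
Proof.
split=> [/Rproj_eq0P <-|[Y ->]]; last by rewrite mulmxA Rproj_mul mul0mx.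
by exists (mpinv A *m C); rewrite mulmxA.
Qed.

End MoorePenrose.

(** * Rank as the trace of the range projection *)

Section Rank.
Variable R : realType.

(** The trace of the orthogonal projection onto the column space of M; it is
    the rank by [qrankE], but is easier to compare because it is additive. *)
Definition trank m n (M : 'M[quat R]_(m, n)) : R := retr (M *m mpinv M).

Lemma trank_qadj m n (M : 'M[quat R]_(m, n)) : trank (qadj M) = trank M.
Proof.
by rewrite /trank mpinv_qadj -qadjM retr_qadj retr_mulC.
Qed.

(** The column space of N lies in that of M, hence each product of the two
    range projections is the smaller one. *)
Lemma range_projB m n1 n2 (M : 'M[quat R]_(m, n1)) (N : 'M_(m, n2)) X :
    N = M *m X ->
  let Q := M *m mpinv M - N *m mpinv N in qadj Q = Q /\ Q *m Q = Q.
Proof.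
move=> defN Q.
have MN : M *m mpinv M *m (N *m mpinv N) = N *m mpinv N.
  by rewrite {1}defN !mulmxA mulmxKmp -defN.
have NM : N *m mpinv N *m (M *m mpinv M) = N *m mpinv N.
  by rewrite -[LHS]qadjK qadjM !qadj_range MN qadj_range.
have hQ : qadj Q = Q by rewrite qadjB !qadj_range.
split=> //; rewrite /Q mulmxBl !mulmxBr MN NM !mulmxA mulmxKmp mulmxKmp.
by rewrite subrr subr0.
Qed.

(** The difference of the two traces is tr Q = tr (Q^* Q) for the projection Q
    of [range_projB], a sum of squared norms. *)
Lemma trank_range_le m n1 n2 (M : 'M[quat R]_(m, n1)) (N : 'M_(m, n2)) X :
  N = M *m X -> trank N <= trank M.
Proof.
move=> /range_projB[hQ QQ]; rewrite -subr_ge0 -retrN -retrD -QQ -{1}hQ.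
exact: retr_gram_ge0.
Qed.

(** Equality forces that sum of squared norms to vanish, so both matrices
    have the same range projection. *)
Lemma trank_range_eq m n1 n2 (M : 'M[quat R]_(m, n1)) (N : 'M_(m, n2)) X :
  N = M *m X -> (trank M = trank N <-> exists Y, M = N *m Y).
Proof.
move=> defN; split=> [e|[Y defM]]; last first.
  by apply/eqP; rewrite eq_le (trank_range_le defM) (trank_range_le defN).
have [hQ QQ] := range_projB defN.
have /eqP : M *m mpinv M - N *m mpinv N = 0.
  apply: retr_gram_eq0; rewrite hQ QQ retrD retrN.
  by rewrite -/(trank M) -/(trank N) e subrr.
rewrite subr_eq0 => /eqP eP; exists (mpinv N *m M).
by rewrite mulmxA -eP mulmxKmp.
Qed.

Lemma trank_mulmx_le m n p q (X : 'M[quat R]_(m, n)) (M : 'M_(n, p))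
  (Y : 'M_(p, q)) : trank (X *m M *m Y) <= trank M.
Proof.
apply: le_trans (trank_range_le (erefl (X *m M *m Y))) _.
rewrite -trank_qadj qadjM -[leRHS]trank_qadj.
exact: trank_range_le (erefl _).
Qed.

(** M *m selmx S replaces the columns of M outside S by zero, which avoids
    submatrices whose size depends on S. *)
Definition selmx n (S : {set 'I_n}) : 'M[quat R]_n :=
  \matrix_(i, j) ((i == j) && (i \in S))%:R.

Lemma selmxE n (S : {set 'I_n}) p (c : 'M_(n, p)) i j :
  (selmx S *m c) i j = if i \in S then c i j else 0.
Proof.
rewrite mxE (bigD1 i) //= mxE eqxx big1 => [|k ki]; last first.
  by rewrite mxE eq_sym (negbTE ki) mul0r.
by rewrite addr0; case: ifP => _; rewrite /= ?mul1r ?mul0r.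
Qed.

Lemma selmx_idem n (S : {set 'I_n}) : selmx S *m selmx S = selmx S.
Proof.
by apply/matrixP => i j; rewrite selmxE mxE; case: (i \in S); rewrite ?andbF.
Qed.

Lemma qadj_selmx n (S : {set 'I_n}) : qadj (selmx S) = selmx S.
Proof.
apply/matrixP => i j; rewrite !mxE [j == i]eq_sym.
case: eqP => [->|_] /=; last by rewrite quat_conj0.
by case: (_ \in _); rewrite ?quat_conj0 ?quat_conj1.
Qed.

Lemma retr_selmx n (S : {set 'I_n}) : retr (selmx S) = #|S|%:R.
Proof.
rewrite /retr /mxtrace q_re_sum -sum1_card natr_sum [RHS]big_mkcond /=.
by apply: eq_bigr => i _; rewrite mxE eqxx /=; case: (_ \in _).
Qed.

(** For D = selmx S and N = M D, the columns of D (1 - N^+ N) are supported in S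
    and killed by M, so D = D N^+ N; the adjoint of this identity gives
    D = N^+ N D = N^+ N. *)
Lemma col_indep_corange m n (M : 'M[quat R]_(m, n)) S :
  col_indep M S -> mpinv (M *m selmx S) *m (M *m selmx S) = selmx S.
Proof.
move=> indS; set N := M *m selmx S.
have DL0 : selmx S *m Lproj N = 0.
  apply/matrixP => i j; rewrite [RHS]mxE.
  have /matrixP/(_ i 0) : col j (selmx S *m Lproj N) = 0.
    apply: indS => [k kS|]; first by rewrite mxE selmxE (negbTE kS).
    by rewrite !colE !mulmxA mul_Lproj mul0mx.
  by rewrite !mxE.
have DG : selmx S *m (mpinv N *m N) = selmx S.
  by apply/eqP; rewrite eq_sym -subr_eq0 -{1}[selmx S]mulmx1 -mulmxBr DL0.
have GD : mpinv N *m N *m selmx S = selmx S.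
  by rewrite -qadj_corange -[in LHS]qadj_selmx -qadjM DG qadj_selmx.
by rewrite -GD /N -!mulmxA selmx_idem.
Qed.

Lemma trank_indep m n (M : 'M[quat R]_(m, n)) S :
  col_indep M S -> trank (M *m selmx S) = #|S|%:R.
Proof. by move=> indS; rewrite /trank retr_mulC col_indep_corange // retr_selmx. Qed.

Lemma qrank_witness m n (M : 'M[quat R]_(m, n)) :
  exists2 S, col_indep M S & qrank M = #|S|.
Proof.
have ind0 : `[< col_indep M set0 >].
  by apply/asboolP => c c0 _; apply/matrixP => j k; rewrite ord1 c0 ?inE // mxE.
pose A := [pred S | `[< col_indep M S >]].
have : (0 < #|A|)%N by apply/card_gt0P; exists set0.
by case/(eq_bigmax_cond (fun S : {set 'I_n} => #|S|)) => S /asboolP indS e; exists S.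
Qed.

(** Projecting a linear relation M c = 0 away from the columns in S leaves only
    the multiple c_j of the component of column j, so c_j = 0. *)
Lemma col_indep_setU1 m n (M : 'M[quat R]_(m, n)) S j :
  col_indep M S -> j \notin S -> Rproj (M *m selmx S) *m col j M != 0 ->
  col_indep M (j |: S).
Proof.
move=> indS jS /eqP nz c supc Mc0.
have dc : c = selmx S *m c + delta_mx j 0 *m (c j 0)%:M.
  apply/matrixP => i k; rewrite ord1 mxE selmxE mxE big_ord1 !mxE eqxx andbT mulr1n.
  have [->|ij] := eqVneq i j; first by rewrite (negbTE jS) add0r mul1r.
  rewrite mul0r addr0; case: ifPn => // iS.
  by apply: supc; rewrite !inE negb_or ij.
have cj0 : c j 0 = 0.
  apply/eqP/negP => /negP cj; apply: nz.
  have : Rproj (M *m selmx S) *m col j M *m (c j 0)%:M = 0.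
    have : Rproj (M *m selmx S) *m (M *m c) = 0 by rewrite Mc0 mulmx0.
    rewrite {1}dc !mulmxDr !mulmxA.
    by rewrite -[Rproj _ *m M *m _]mulmxA Rproj_mul mul0mx add0r colE mulmxA.
  move/(congr1 (mulmx^~ ((c j 0)^-1)%:M)) => /=; rewrite mul0mx.
  by rewrite -!mulmxA -scalar_mxM mulrV // mulmx1.
apply: indS => // i iS; have [->//|ij] := eqVneq i j.
by apply: supc; rewrite !inE negb_or ij.
Qed.

(** A largest independent set S of columns spans the column space, since
    [col_indep_setU1] would enlarge it otherwise. Hence M and M *m selmx S have
    the same range projection, whose trace is the cardinal of S. *)
Lemma qrankE m n (M : 'M[quat R]_(m, n)) : (qrank M)%:R = trank M.
Proof.
have [S indS eS] := qrank_witness M.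
rewrite eS -(trank_indep indS); apply/esym/(trank_range_eq (erefl _)).
apply/Rproj_range/matrixP => i j; rewrite [RHS]mxE.
suff /matrixP/(_ i 0) : Rproj (M *m selmx S) *m col j M = 0.
  by rewrite colE mulmxA -colE !mxE.
have [jS|jS] := boolP (j \in S).
  suff -> : col j M = M *m selmx S *m delta_mx j 0 by rewrite mulmxA Rproj_mul mul0mx.
  rewrite -mulmxA colE; congr (_ *m _); apply/matrixP => k l; rewrite selmxE.
  by case: ifPn => // kS; rewrite mxE; case: eqP kS => // ->; rewrite jS.
apply/eqP/negP => /negP nz.
have /asboolP ind := col_indep_setU1 indS jS nz.
have := @leq_bigmax_cond _ (fun S => `[< col_indep M S >]) (fun S => #|S|) _ ind.
by rewrite -/(qrank M) eS cardsU1 jS ltnn.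
Qed.

Lemma qrank_eqE m n p q (M : 'M[quat R]_(m, n)) (N : 'M_(p, q)) :
  qrank M = qrank N <-> trank M = trank N.
Proof. by rewrite -!qrankE; split=> [->//|/eqP]; rewrite eqr_nat => /eqP. Qed.

Lemma qrank_qadj m n (M : 'M[quat R]_(m, n)) : qrank (qadj M) = qrank M.
Proof. by apply/qrank_eqE/trank_qadj. Qed.

Lemma qrank_equiv m n p q (M : 'M[quat R]_(m, n)) (N : 'M_(p, q)) X Y X' Y' :
  M = X *m N *m Y -> N = X' *m M *m Y' -> qrank M = qrank N.
Proof.
move=> eM eN; apply/qrank_eqE/eqP; rewrite eq_le.
by apply/andP; split; [rewrite eM|rewrite eN]; apply: trank_mulmx_le.
Qed.

(** The matrix without the middle block has its column space inside that of the
    full matrix, so equal ranks mean that the block C adds nothing. *)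
Lemma qrank_insert m n1 n2 n3 (P : 'M[quat R]_(m, n1)) (C : 'M_(m, n2))
    (Q : 'M_(m, n3)) :
  qrank (row_mx P (row_mx C Q)) = qrank (row_mx P Q) <->
  exists Y Z, C = P *m Y + Q *m Z.
Proof.
have e : row_mx P Q =
    row_mx P (row_mx C Q) *m block_mx 1%:M 0 0 (col_mx 0 1%:M).
  by rewrite mul_row_block mul_row_col !mulmx0 !mulmx1 !add0r addr0.
rewrite qrank_eqE (trank_range_eq e); split=> [[Y]|[Y [Z defC]]].
  rewrite -[Y]vsubmxK -[usubmx Y]hsubmxK -[dsubmx Y]hsubmxK.
  rewrite -[rsubmx (usubmx Y)]hsubmxK -[rsubmx (dsubmx Y)]hsubmxK.
  rewrite mul_row_col !mul_mx_row !add_row_mx => /eq_row_mx[_ /eq_row_mx[eC _]].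
  by rewrite eC; do 2!eexists.
exists (col_mx (row_mx 1%:M (row_mx Y 0)) (row_mx 0 (row_mx Z 1%:M))).
rewrite mul_row_col !mul_mx_row !add_row_mx !mulmx0 !mulmx1 defC.
by rewrite addr0 add0r.
Qed.

Lemma qrank_row_mx m n1 n2 (A : 'M[quat R]_(m, n1)) (C : 'M_(m, n2)) :
  qrank (row_mx A C) = qrank A <-> Rproj A *m C = 0.
Proof.
have e : A = row_mx A C *m col_mx 1%:M 0.
  by rewrite mul_row_col mulmx1 mulmx0 addr0.
rewrite qrank_eqE (trank_range_eq e) Rproj_range; split=> [[Y]|[Y ->]].
  by rewrite -[Y]hsubmxK mul_mx_row => /eq_row_mx[_ eC]; exists (rsubmx Y).
by exists (row_mx 1%:M Y); rewrite mul_mx_row mulmx1.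
Qed.

(** The hypotheses make the columns of G orthogonal to those of A and its rows
    orthogonal to those of B. The Moore-Penrose inverse is therefore taken block
    by block, and the traces of the three range projections add up. *)
Lemma trank_antitriangular m n p q (A : 'M[quat R]_(m, n)) (B : 'M_(p, q))
    (G : 'M_(m, q)) :
  Rproj A *m G = G -> G *m Lproj B = G ->
  trank (block_mx G A B 0) = trank A + trank B + trank G.
Proof.
move=> RG GL.
have GB : G *m mpinv B = 0 by rewrite -GL -mulmxA Lproj_mpinv mulmx0.
have AG : mpinv A *m G = 0 by rewrite -RG mulmxA mpinv_Rproj mul0mx.
have BG : B *m mpinv G = 0.
  by rewrite -(mpinv_absorbl (qadj_Lproj B) GL) mulmxA mul_Lproj mul0mx.
have GA : mpinv G *m A = 0.
  by rewrite -(mpinv_absorbr (qadj_Rproj A) RG) -mulmxA Rproj_mul mulmx0.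
pose N := block_mx (mpinv G) (mpinv B) (mpinv A) 0.
have MN : block_mx G A B 0 *m N =
    block_mx (G *m mpinv G + A *m mpinv A) 0 0 (B *m mpinv B).
  by rewrite mulmx_block GB BG !mulmx0 !mul0mx !addr0.
have NM : N *m block_mx G A B 0 =
    block_mx (mpinv G *m G + mpinv B *m B) 0 0 (mpinv A *m A).
  by rewrite mulmx_block GA AG !mulmx0 !mul0mx !addr0.
have -> : trank (block_mx G A B 0) = retr (block_mx G A B 0 *m N).
  rewrite /trank; congr (retr (_ *m _)); apply: mpinv_eq; split.
  - rewrite MN mulmx_block !mulmx0 !mul0mx !addr0 !add0r !mulmxDl !mulmxKmp.
    by rewrite -!mulmxA AG GA !mulmx0 addr0 add0r.
  - rewrite NM mulmx_block !mulmx0 !mul0mx !addr0 !add0r !mulmxDl !mpinvK2.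
    by rewrite -!mulmxA BG GB !mulmx0 addr0 add0r.
  - by rewrite MN qadj_block !qadj0 qadjD !qadj_range.
  - by rewrite NM qadj_block !qadj0 qadjD !qadj_corange.
by rewrite MN retr_block retrD -addrA addrC.
Qed.

Lemma trank_eq0 m n (M : 'M[quat R]_(m, n)) : trank M = 0 -> M = 0.
Proof.
move=> r0; have : M *m mpinv M = 0.
  by apply: retr_gram_eq0; rewrite qadj_range mulmxA mulmxKmp.
by move=> e; rewrite -[M]mulmxKmp e mul0mx.
Qed.

End Rank.

Section Bordered.
Variable R : realType.

(** The blocks A f and g B are removed by column and row operations, and so is
    the part A al + be B of E; what remains of E is R_A E L_B. *)
Lemma qrank_bordered m n p q r s (A : 'M[quat R]_(m, n)) (B : 'M_(p, q))
    (E : 'M_(m, q)) (f : 'M_(n, r)) (g : 'M_(s, p)) :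
  qrank (col_mx (row_mx E (row_mx A (A *m f)))
           (col_mx (row_mx B (row_mx (0 : 'M_(p, n)) (0 : 'M_(p, r))))
                   (row_mx (g *m B) (row_mx (0 : 'M_(s, n)) (0 : 'M_(s, r))))))
    = (qrank A + qrank B)%N <->
  Rproj A *m E *m Lproj B = 0.
Proof.
set M := col_mx _ _; set G := Rproj A *m E *m Lproj B.
pose al := mpinv A *m E; pose be := Rproj A *m E *m mpinv B.
have eE : E = G + A *m al + be *m B.
  rewrite addrAC /G /Lproj mulmxBr mulmx1 mulmxA subrK.
  by rewrite /Rproj mulmxBl mul1mx -mulmxA subrK.
pose X : 'M[quat R]_(m + (p + s), m + p) :=
  col_mx (row_mx 1%:M be) (col_mx (row_mx 0 1%:M) (row_mx 0 g)).
pose Y : 'M[quat R]_(q + n, q + (n + r)) :=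
  row_mx (col_mx 1%:M al) (row_mx (col_mx 0 1%:M) (col_mx 0 f)).
have eM : M = X *m block_mx G A B 0 *m Y.
  rewrite /X /Y !mul_col_mx !mul_row_block !mul_mx_row !mul_row_col.
  rewrite !mulmx0 !mul0mx !mul1mx !mulmx1 !addr0 !add0r !mul0mx !addr0.
  by rewrite /M {1}eE addrAC.
pose X' : 'M[quat R]_(m + p, m + (p + s)) :=
  col_mx (row_mx 1%:M (row_mx (- be) 0)) (row_mx 0 (row_mx 1%:M 0)).
pose Y' : 'M[quat R]_(q + (n + r), q + n) :=
  row_mx (col_mx 1%:M (col_mx (- al) 0)) (col_mx 0 (col_mx 1%:M 0)).
have eN : block_mx G A B 0 = X' *m M *m Y'.
  have mulX' c (r1 : 'M_(m, c)) (r2 : 'M_(p, c)) (r3 : 'M_(s, c)) :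
      X' *m col_mx r1 (col_mx r2 r3) = col_mx (r1 - be *m r2) r2.
    rewrite /X' mul_col_mx !mul_row_col !mul1mx !mul0mx mulNmx.
    by rewrite !addr0 !add0r.
  have mulY' c (c1 : 'M_(c, q)) (c2 : 'M_(c, n)) (c3 : 'M_(c, r)) :
      row_mx c1 (row_mx c2 c3) *m Y' = row_mx (c1 - c2 *m al) c2.
    rewrite /Y' mul_mx_row !mul_row_col !mulmx1 !mulmx0 mulmxN.
    by rewrite !addr0 !add0r.
  rewrite mulX' mul_col_mx mulY' mul0mx subr0.
  have -> : be *m row_mx B (row_mx 0 0) = row_mx (be *m B) 0 :> 'M_(m, q + (n + r)).
    by rewrite row_mx0 mul_mx_row mulmx0.
  rewrite opp_row_mx oppr0 add_row_mx addr0 mulY'.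
  by rewrite block_mxEv eE !addrK.
have {}eM := qrank_equiv eM eN.
have {}eN : (qrank (block_mx G A B 0))%:R = (qrank A + qrank B)%:R + trank G :> R.
  rewrite natrD !qrankE trank_antitriangular // /G.
    by rewrite !mulmxA Rproj_idem.
  by rewrite -!mulmxA Lproj_idem.
rewrite eM; split=> [e|G0].
  by apply/trank_eq0/eqP; move/eqP: eN; rewrite e eq_sym -subr_eq0 addrC addKr.
by apply/eqP; rewrite -(eqr_nat R) eN G0 /trank mul0mx retr0 addr0.
Qed.

End Bordered.

(** * The pair of equations A X = C, X B = D *)

Section TwoSided.
Variable R : realType.

(** The second equation holds because A^+ C B = A^+ A D, which L_A D completes
    to D. *)
Lemma two_sided_solution m n p q (A : 'M[quat R]_(m, n)) (B : 'M_(p, q)) C D U :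
    Rproj A *m C = 0 -> D *m Lproj B = 0 -> A *m D = C *m B ->
  let X := mpinv A *m C + Lproj A *m D *m mpinv B + Lproj A *m U *m Rproj B in
  A *m X = C /\ X *m B = D.
Proof.
move=> /Rproj_eq0P eC /Lproj_eq0P eD eAD X; split.
  by rewrite !mulmxDr !mulmxA eC mul_Lproj !mul0mx !addr0.
rewrite /X 2!mulmxDl -[Lproj A *m U *m _ *m _]mulmxA Rproj_mul mulmx0 addr0.
rewrite -!mulmxA -eAD (mulmxA D) eD !mulmxA /Lproj mulmxBl mul1mx.
by rewrite addrC subrK.
Qed.

(** Every X is of the form given by [two_sided_solution], with X itself as the
    free parameter. *)
Lemma two_sided_general m n p q (A : 'M[quat R]_(m, n)) (B : 'M_(p, q)) X :
  X = mpinv A *m (A *m X) + Lproj A *m (X *m B) *m mpinv B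
      + Lproj A *m X *m Rproj B.
Proof.
have e : Lproj A *m (X *m B) *m mpinv B + Lproj A *m X *m Rproj B = Lproj A *m X.
  by rewrite /Rproj mulmxBr mulmx1 !mulmxA addrC subrK.
by rewrite -addrA e /Lproj mulmxBl mul1mx mulmxA addrC subrK.
Qed.

End TwoSided.

(** * The eta-adjoint *)

Section EtaAdjoint.
Variables (R : realType) (eta : quat R).
Hypothesis eta_unit : eta \in [:: quatI R; quatJ R; quatK R].

Lemma eta_sqr : eta * eta = -1.
Proof.
move: eta_unit; rewrite !inE => /or3P[] /eqP ->.
all: by congr Quat => /=; ring.
Qed.

Lemma eta_conj : quat_conj eta = - eta.
Proof.
move: eta_unit; rewrite !inE => /or3P[] /eqP ->.
all: by congr Quat; rewrite /= ?oppr0.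
Qed.

Lemma eta_mxK m n (M : 'M[quat R]_(m, n)) : eta%:M *m (eta%:M *m M) = - M.
Proof. by rewrite mulmxA -scalar_mxM eta_sqr raddfN mulNmx mul1mx. Qed.

Lemma etaadjD m n (M N : 'M[quat R]_(m, n)) :
  etaadj eta (M + N) = etaadj eta M + etaadj eta N.
Proof. by rewrite /etaadj qadjD mulmxDr mulmxDl opprD. Qed.

Lemma etaadjN m n (M : 'M[quat R]_(m, n)) : etaadj eta (- M) = - etaadj eta M.
Proof. by rewrite /etaadj qadjN mulmxN mulNmx. Qed.

Lemma etaadjB m n (M N : 'M[quat R]_(m, n)) :
  etaadj eta (M - N) = etaadj eta M - etaadj eta N.
Proof. by rewrite etaadjD etaadjN. Qed.

Lemma etaadjM m n p (M : 'M[quat R]_(m, n)) (N : 'M_(n, p)) :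
  etaadj eta (M *m N) = etaadj eta N *m etaadj eta M.
Proof.
rewrite /etaadj mulNmx mulmxN opprK qadjM -!mulmxA eta_mxK.
by rewrite !mulmxN !mulmxA.
Qed.

Lemma qadj_etaadj m n (M : 'M[quat R]_(m, n)) :
  qadj (etaadj eta M) = etaadj eta (qadj M).
Proof.
have etaN k : (- eta)%:M = - eta%:M :> 'M_k by rewrite raddfN.
rewrite /etaadj qadjN !qadjM !qadj_scalar eta_conj !etaN.
by rewrite mulNmx !mulmxN opprK mulmxA.
Qed.

Lemma etaadjK m n (M : 'M[quat R]_(m, n)) : etaadj eta (etaadj eta M) = M.
Proof.
rewrite /etaadj -/(etaadj eta M) qadj_etaadj /etaadj qadjK mulmxN mulNmx opprK.
by rewrite -!mulmxA eta_mxK -scalar_mxM eta_sqr raddfN mulmxN opprK mulmx1.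
Qed.

Lemma mpinv_etaadj m n (M : 'M[quat R]_(m, n)) :
  mpinv (etaadj eta M) = etaadj eta (mpinv M).
Proof.
apply: mpinv_eq; split; rewrite -!etaadjM.
- by rewrite mulmxA mulmxKmp.
- by rewrite mulmxA mpinvK2.
- by rewrite qadj_etaadj qadj_corange.
- by rewrite qadj_etaadj qadj_range.
Qed.

(** Up to the invertible scalars eta, this is the adjoint of M. *)
Lemma qrank_etaadj m n (M : 'M[quat R]_(m, n)) : qrank (etaadj eta M) = qrank M.
Proof.
rewrite -[RHS]qrank_qadj.
apply: (@qrank_equiv _ _ _ _ _ _ _ (- eta%:M) eta%:M eta%:M (- eta%:M)).
  by rewrite /etaadj !mulNmx.
rewrite /etaadj !mulmxN !mulNmx opprK -!mulmxA eta_mxK -scalar_mxM eta_sqr.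
by rewrite raddfN mulmxN mulmx1 opprK.
Qed.

End EtaAdjoint.

(** * The system A U q = C, L U a = D with projections L and q *)

Section ProjectedSystem.
Variables (R : realType) (m n p r : nat).
Variables (L : 'M[quat R]_n) (A : 'M[quat R]_(m, n)).
Variables (q : 'M[quat R]_p) (a : 'M[quat R]_(p, r)).
Variables (C : 'M[quat R]_(m, p)) (D : 'M[quat R]_(n, r)).
Hypotheses (LL : L *m L = L) (hL : qadj L = L) (AL : A *m L = A).
Hypotheses (qq : q *m q = q) (hq : qadj q = q) (qa : q *m a = a).
Hypotheses (Cq : C *m q = C) (Da : D *m Lproj a = 0).

(** Since A L = A and q a = a, the system constrains only V = L U q, through
    A V = C and V a = D. The projection P onto the column space of A^* lies
    below L, so L - P is again an orthogonal projection; the matrices defined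
    next are expressed through L and P in [A00E], [B00E], [C00E] and [D00E]. *)
Let P := mpinv A *m A.

Definition proj_A00 := L *m Lproj A.
Definition proj_B00 := Rproj q *m a.
Definition proj_C00 := D - L *m mpinv A *m C *m mpinv q *m a.
Definition proj_D00 := Rproj proj_A00 *m L.
Definition proj_Phi :=
  mpinv A *m C *m mpinv q
  + Lproj A *m mpinv proj_A00 *m proj_C00 *m mpinv a
  - Lproj A *m mpinv proj_A00 *m L *m mpinv proj_D00 *m Rproj proj_A00
      *m proj_C00 *m mpinv a
  + mpinv proj_D00 *m Rproj proj_A00 *m proj_C00 *m mpinv proj_B00 *m Rproj q.

Let Lm : L *m mpinv A = mpinv A. Proof. exact: mpinv_absorbl. Qed.
Let LP : L *m P = P. Proof. by rewrite mulmxA Lm. Qed.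
Let PL : P *m L = P. Proof. by rewrite -mulmxA AL. Qed.
Let PP : P *m P = P. Proof. by rewrite mulmxA mpinvK2. Qed.
Let hP : qadj P = P. Proof. exact: qadj_corange. Qed.

Let QQ : (L - P) *m (L - P) = L - P.
Proof. by rewrite mulmxBl !mulmxBr LL LP PL PP subrr subr0. Qed.

Let hQ : qadj (L - P) = L - P. Proof. by rewrite qadjB hL hP. Qed.

Let A00E : proj_A00 = L - P. Proof. by rewrite /proj_A00 mulmxBr mulmx1 LP. Qed.

Let mpA00 : mpinv proj_A00 = L - P. Proof. by rewrite A00E mpinv_proj. Qed.

Let RA00 : Rproj proj_A00 = 1%:M - (L - P).
Proof. by rewrite /Rproj mpA00 A00E QQ. Qed.

Let LA00 : Lproj proj_A00 = 1%:M - (L - P).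
Proof. by rewrite /Lproj mpA00 A00E QQ. Qed.

Let D00E : proj_D00 = P.
Proof. by rewrite /proj_D00 RA00 mulmxBl mul1mx mulmxBl LL PL opprB addrC subrK. Qed.

Let B00E : proj_B00 = 0.
Proof. by rewrite /proj_B00 /Rproj (mpinv_proj qq hq) qq mulmxBl mul1mx qa subrr. Qed.

Let C00E : proj_C00 = D - mpinv A *m C *m a.
Proof. by rewrite /proj_C00 (mpinv_proj qq hq) Lm -[X in _ - X]mulmxA qa. Qed.

Let LAQ : Lproj A *m (L - P) = L - P.
Proof. by rewrite mulmxBr /Lproj !mulmxBl !mul1mx PL PP subrr subr0. Qed.

Let Qm : (L - P) *m mpinv A = 0.
Proof. by rewrite mulmxBl Lm mpinvK2 subrr. Qed.

(** The third term of the definition contains (L - P) P = 0 and the fourth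
    contains the inverse of B00 = 0. *)
Let PhiE : proj_Phi = mpinv A *m C + (L - P) *m D *m mpinv a.
Proof.
rewrite /proj_Phi mpA00 LAQ B00E mpinv0 mulmx0 mul0mx addr0 D00E.
rewrite (mpinv_proj PP hP) -[(L - P) *m L *m P]mulmxA LP.
have QP : (L - P) *m P = 0 by rewrite mulmxA Qm mul0mx.
rewrite QP !mul0mx subr0 (mpinv_proj qq hq) -mulmxA Cq.
by rewrite C00E mulmxBr !mulmxA Qm !mul0mx subr0.
Qed.

(** With L D = D, the residual equals P D - A^+ C a, and multiplication by A,
    which loses nothing on the column space of A^+, turns it into A D - C a. *)
Lemma projected_consistency :
    Rproj A *m C = 0 -> Rproj L *m D = 0 ->
  (Rproj proj_A00 *m proj_C00 *m Lproj proj_B00 = 0 <-> A *m D = C *m a).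
Proof.
move=> /Rproj_eq0P eC; rewrite {1}/Rproj (mpinv_proj LL hL) LL mulmxBl mul1mx.
move=> /eqP; rewrite subr_eq0 => /eqP eD.
have -> : Rproj proj_A00 *m proj_C00 *m Lproj proj_B00 = P *m D - mpinv A *m C *m a.
  rewrite B00E /Lproj mulmx0 subr0 mulmx1 RA00 C00E mulmxBl mul1mx.
  rewrite mulmxBr !mulmxA Qm !mul0mx subr0 mulmxBl -eD.
  by rewrite opprB addrC addrA subrK.
rewrite -!mulmxA; split=> [/eqP|->]; last exact: subrr.
rewrite subr_eq0 => /eqP/(congr1 (mulmx A)).
by rewrite !mulmxA mulmxKmp eC.
Qed.

(** The three conditions are those of the pair A V = C, V a = D, whose solution
    from [two_sided_solution] is also a value of U. *)
Lemma projected_solvable :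
  (exists U, A *m U *m q = C /\ L *m U *m a = D) <->
  [/\ Rproj A *m C = 0, Rproj L *m D = 0
    & Rproj proj_A00 *m proj_C00 *m Lproj proj_B00 = 0].
Proof.
split=> [[U [eC eD]]|[RC RD RCL]].
  have RC : Rproj A *m C = 0 by rewrite -eC !mulmxA Rproj_mul !mul0mx.
  have RD : Rproj L *m D = 0 by rewrite -eD !mulmxA Rproj_mul !mul0mx.
  split; [exact: RC|exact: RD|apply/(projected_consistency RC RD)].
  by rewrite -eC -eD !mulmxA AL -[RHS]mulmxA qa.
move/(projected_consistency RC RD): RCL => eAD.
have [eC eD] := two_sided_solution 0 RC Da eAD.
move: eC eD; set X := _ + _ => eC eD; exists X.
rewrite eC Cq; split; first exact: erefl.
by rewrite -mulmxA eD; move/Rproj_eq0P: RD; rewrite (mpinv_proj LL hL) LL.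
Qed.

(** Here Phi = A^+ C + L_A D a^+ and L_A L_A00 = 1 - L, so the U2, U3 and U5
    terms range over the matrices W with L W q = 0, while Phi and the U4 term
    are the general solution of the pair A V = C, V a = D. *)
Lemma projected_general U :
    (exists U, A *m U *m q = C /\ L *m U *m a = D) ->
  (A *m U *m q = C /\ L *m U *m a = D) <->
  exists U2 U3 U4 U5 : 'M_(n, p),
    U = proj_Phi + Lproj A *m Lproj proj_A00 *m U2 + U3 *m Rproj proj_B00 *m Rproj q
        + Lproj A *m U4 *m Rproj a + Lproj L *m U5 *m Rproj q.
Proof.
move=> solv; case/projected_solvable: (solv) => RC RD.
move/(projected_consistency RC RD) => eAD.
have LD : L *m D = D.
  by move/Rproj_eq0P: RD; rewrite (mpinv_proj LL hL) LL.
have PhiE2 : proj_Phi = mpinv A *m C + Lproj A *m D *m mpinv a.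
  suff <- : (L - P) *m D = Lproj A *m D by exact: PhiE.
  by rewrite (mulmxBl L P D) LD (mulmxBl 1%:M _ D) mul1mx.
have LL00 : Lproj A *m Lproj proj_A00 = 1%:M - L.
  by rewrite LA00 mulmxBr mulmx1 LAQ /Lproj -/P opprB addrA subrK.
have RB : Rproj proj_B00 = 1%:M by rewrite B00E /Rproj mul0mx subr0.
have Rq : Rproj q = 1%:M - q by rewrite /Rproj (mpinv_proj qq hq) qq.
have LLp : Lproj L = 1%:M - L by rewrite /Lproj (mpinv_proj LL hL) LL.
have A1L : A *m (1%:M - L) = 0 by rewrite mulmxBr mulmx1 AL subrr.
have q1q : (1%:M - q) *m q = 0 by rewrite mulmxBl mul1mx qq subrr.
have qa0 : (1%:M - q) *m a = 0 by rewrite mulmxBl mul1mx qa subrr.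
have L1L : L *m (1%:M - L) = 0 by rewrite mulmxBr mulmx1 LL subrr.
rewrite PhiE2 LL00 RB Rq LLp; split; last first.
  case=> U2 [U3 [U4 [U5 ->]]]; rewrite mulmx1.
  have regroup (V : zmodType) (t b c u d : V) :
      t + b + c + u + d = t + u + (b + c + d).
    by rewrite (addrAC _ c u) (addrAC t b u) !addrA.
  have [] := two_sided_solution U4 RC Da eAD; rewrite regroup.
  move: (_ + _ + Lproj A *m U4 *m _) => X eC eD.
  have AWq : A *m ((1%:M - L) *m U2 + U3 *m (1%:M - q)
                   + (1%:M - L) *m U5 *m (1%:M - q)) *m q = 0.
    rewrite 2!mulmxDr !(mulmxA A) A1L !mul0mx add0r addr0.
    by rewrite -(mulmxA _ _ q) q1q mulmx0.
  have LWa : L *m ((1%:M - L) *m U2 + U3 *m (1%:M - q)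
                   + (1%:M - L) *m U5 *m (1%:M - q)) *m a = 0.
    rewrite 2!mulmxDr !(mulmxA L) L1L !mul0mx add0r addr0.
    by rewrite -(mulmxA _ _ a) qa0 mulmx0.
  move: (_ + _ + _) AWq LWa => W AWq LWa.
  rewrite (mulmxDr A) (mulmxDr L) (mulmxDl (A *m X)) (mulmxDl (L *m X)).
  by rewrite AWq LWa (addr0 (A *m X *m q)) (addr0 (L *m X *m a)) eC Cq -mulmxA eD.
(* U = V + (1 - L) U + L U (1 - q) for V = L U q, and V is its own parameter. *)
case=> eC eD; exists U, (L *m U), (L *m U *m q), 0.
rewrite mulmx0 mul0mx addr0 mulmx1.
have eAV : A *m (L *m U *m q) = C by rewrite !mulmxA AL.
have eVa : L *m U *m q *m a = D by rewrite -mulmxA qa.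
have := two_sided_general A a (L *m U *m q).
rewrite eAV eVa => eV.
rewrite [RHS]addrAC [X in _ = X + _]addrAC -eV mulmxBl mul1mx mulmxBr mulmx1.
have tel (V : zmodType) (x y z : V) : z + (x - y) + (y - z) = x.
  by rewrite addrC addrA subrK addrC subrK.
by rewrite tel.
Qed.

End ProjectedSystem.

(** * The coefficient equations and their eta-Hermitian solutions *)

Section Halving.
Variable R : realType.

Definition half m n (M : 'M[quat R]_(m, n)) := (2%:R : quat R)^-1 *: M.

Lemma half_double m n (M : 'M[quat R]_(m, n)) : half (M + M) = M.
Proof.
have u2 : (2%:R : quat R) \is a GRing.unit.
  by apply/eqP => /(congr1 (@q_re R))/eqP; rewrite /= (pnatr_eq0 R 2).
by rewrite /half -mulr2n -scaler_nat scalerA mulVr // scale1r.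
Qed.

Lemma halfD m n (M N : 'M[quat R]_(m, n)) : half (M + N) = half M + half N.
Proof. exact: scalerDr. Qed.

(** Scalars act on the left only, but half N is the unique matrix whose double
    is N, and doubling commutes with products. *)
Lemma mulmx_half m n p (M : 'M[quat R]_(m, n)) (N : 'M_(n, p)) :
  M *m half N = half (M *m N).
Proof. by rewrite -[LHS]half_double -mulmxDr -halfD half_double. Qed.

End Halving.

Section CoefficientEquations.
Variables (R : realType) (n : nat).
(** The eta-adjoint enters only through the four properties of s below. *)
Variable s : 'M[quat R]_n -> 'M[quat R]_n.
Hypotheses (sK : involutive s) (sB : {morph s : M N / M - N}).
Hypothesis sM : forall M N, s (M *m N) = s N *m s M.
Hypothesis s_mpinv : forall M, mpinv (s M) = s (mpinv M).

Let s0 : s 0 = 0. Proof. by have := sB 0 0; rewrite !subrr. Qed.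

Let sD M N : s (M + N) = s M + s N.
Proof. by rewrite -{1}[N]opprK sB -[- N]sub0r sB s0 sub0r opprK. Qed.

Let s1 : s 1%:M = 1%:M.
Proof. by rewrite -[LHS]mulmx1 -{2}[1%:M]sK -sM mulmx1 sK. Qed.

Let s_Rproj M : s (Rproj M) = Lproj (s M).
Proof. by rewrite /Lproj s_mpinv -sM -{1}s1 -sB. Qed.

Let s_Lproj M : s (Lproj M) = Rproj (s M).
Proof. by rewrite /Rproj s_mpinv -sM -{1}s1 -sB. Qed.

Definition symmetrize M := half (M + s M).

Let symmetrize_fix M : s (symmetrize M) = symmetrize M.
Proof. by rewrite -[LHS]half_double -sD /symmetrize -halfD half_double sD sK addrC. Qed.

Variables A0 A1 B0 B1 : 'M[quat R]_n.
Hypotheses (B0_herm : s B0 = B0) (B1_herm : s B1 = B1).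

Local Notation "M ^e" := (s M) (at level 8, format "M ^e").

(** The intermediate matrices are variables fixed by equations rather than
    definitions, so that they stay folded in the computations. X00 is the
    particular solution of the equations for X0, and F is the common value of
    the two sides of the second commutation condition. *)
Variables X00 B11 D11 A11 A2 C2 C3 B2 F : 'M[quat R]_n.
Hypothesis X00E : X00 = mpinv A0 *m B0 + Lproj A0 *m B0 *m mpinv A0^e.
Hypothesis B11E : B11 = B1 - A1 *m X00.
Hypothesis D11E : D11 = B1 - X00 *m A1^e.
Hypothesis A11E : A11 = A1 *m Lproj A0.
Hypothesis A2E : A2 = Rproj A0 *m A11.
Hypothesis C2E : C2 = Rproj A0 *m B11.
Hypothesis C3E : C3 = D11 *m Lproj A0^e.
Hypothesis B2E : B2 = Rproj A0^e.
Hypothesis FE : F = B1 *m A0^e - A1 *m B0.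

Definition gen_std U := X00 + Lproj A0 *m U *m B2.
Definition gen_inf U U1 :=
  mpinv A0 *m (B11 - A11 *m U *m B2)
  + Lproj A0 *m (D11 - Lproj A0 *m U *m A11^e) *m mpinv A0^e
  + Lproj A0 *m U1 *m B2.

Definition commutation :=
  A0 *m B0 = B0 *m A0^e /\ A0 *m B1 - B0 *m A1^e = B1 *m A0^e - A1 *m B0.

Definition two_sided X0 X1 :=
  [/\ A0 *m X0 = B0, X0 *m A0^e = B0,
      A0 *m X1 = B1 - A1 *m X0 & X1 *m A0^e = B1 - X0 *m A1^e].

Definition solves_parts X0 X1 := A0 *m X0 = B0 /\ A0 *m X1 + A1 *m X0 = B1.

Let B2e : B2^e = Lproj A0.
Proof. rewrite B2E s_Rproj sK; reflexivity. Qed.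
Let A11e : A11^e = B2 *m A1^e.
Proof. rewrite A11E sM s_Lproj B2E; reflexivity. Qed.
Let A2e : A2^e = B2 *m A1^e *m Lproj A0^e.
Proof. rewrite A2E sM A11e s_Rproj; reflexivity. Qed.

(** The additional equations are the images under s of the given ones. *)
Lemma hermitian_two_sided X0 X1 :
    X0^e = X0 -> X1^e = X1 -> solves_parts X0 X1 -> two_sided X0 X1.
Proof.
move=> hX0 hX1 [e0 e1]; have e1' : A0 *m X1 = B1 - A1 *m X0.
  rewrite -e1 addrK; reflexivity.
split; [exact: e0| |exact: e1'|].
  rewrite -{1}hX0 -sM e0 B0_herm; reflexivity.
rewrite -{1}hX1 -sM e1' sB sM B1_herm hX0; reflexivity.
Qed.

(** Both conditions compare the two ways of computing A0 X0 s(A0) and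
    A0 X1 s(A0). *)
Lemma two_sided_commutation X0 X1 : two_sided X0 X1 -> commutation.
Proof.
move=> [e1 e2 e3 e4]; split.
  rewrite -{1}e2 mulmxA e1; reflexivity.
have eB1 : B1 = X1 *m A0^e + X0 *m A1^e.
  rewrite e4 subrK; reflexivity.
have eAB : A0 *m B1 = A0 *m X1 *m A0^e + B0 *m A1^e.
  rewrite {1}eB1 mulmxDr !mulmxA e1; reflexivity.
rewrite eAB (addrK (B0 *m A1^e)) e3 mulmxBl -(mulmxA A1) e2; reflexivity.
Qed.

(** B0 and B1 are fixed by s, so applying s to the right-hand equations shows
    that s(X0), s(X1) solve the left-hand ones; these are affine in (X0, X1). *)
Lemma symmetrize_solves X0 X1 :
    two_sided X0 X1 ->
  [/\ solves_parts (symmetrize X0) (symmetrize X1), (symmetrize X0)^e = symmetrize X0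
    & (symmetrize X1)^e = symmetrize X1].
Proof.
move=> [e1 e2 e3 e4].
have f0 : A0 *m X0^e = B0.
  rewrite -[A0]sK -sM e2 B0_herm; reflexivity.
have f1 : A0 *m X1^e = B1 - A1 *m X0^e.
  rewrite -[A0]sK -sM e4 sB sM sK B1_herm; reflexivity.
split; [split|exact: symmetrize_fix|exact: symmetrize_fix];
  rewrite /symmetrize !mulmx_half mulmxDr.
  rewrite e1 f0 half_double; reflexivity.
rewrite e3 f1 mulmxDr -halfD addrACA !subrK half_double; reflexivity.
Qed.

Definition consistency_residual :=
  Rproj (proj_A00 B2^e A2) *m proj_C00 B2^e A2 B2 A2^e C2 C3
  *m Lproj (proj_B00 B2 A2^e).

Section Compatible.
Hypotheses (comm : commutation) (RB0 : Rproj A0 *m B0 = 0).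

Let BL0 : B0 *m Lproj A0^e = 0.
Proof. rewrite -s_Rproj -{1}B0_herm -sM RB0 s0; reflexivity. Qed.

Let X00_solves : A0 *m X00 = B0 /\ X00 *m A0^e = B0.
Proof.
have := two_sided_solution 0 RB0 BL0 comm.1.
by rewrite mulmx0 mul0mx addr0 -X00E.
Qed.

Let AX00 : A0 *m X00 = B0. Proof. by case: X00_solves. Qed.
Let X00A : X00 *m A0^e = B0. Proof. by case: X00_solves. Qed.

(** This symmetry is what makes the two equations for U images of each other:
    C3 = s(C2) below. *)
Let X00_herm : X00^e = X00.
Proof.
rewrite X00E sD !sM -!s_mpinv sK B0_herm s_Lproj.
have -> : B0 *m Rproj A0^e = B0 - A0 *m B0 *m mpinv A0^e.
  by rewrite (mulmxBr B0) mulmx1 mulmxA comm.1.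
rewrite mulmxBr (mulmxBl 1%:M) mulmxBl mul1mx !mulmxA.
by rewrite addrCA.
Qed.

Let FE2 : F = A0 *m B1 - B0 *m A1^e. Proof. rewrite FE comm.2; reflexivity. Qed.

Let AD11 : A0 *m D11 = F.
Proof. rewrite D11E mulmxBr mulmxA AX00 FE2; reflexivity. Qed.

Let B11A : B11 *m A0^e = F.
Proof. rewrite B11E mulmxBl -mulmxA X00A FE; reflexivity. Qed.

Let RF : Rproj A0 *m F = 0.
Proof. rewrite FE2 mulmxBr !mulmxA Rproj_mul RB0 !mul0mx subrr; reflexivity. Qed.

Let FL : F *m Lproj A0^e = 0.
Proof. rewrite FE mulmxBl -!mulmxA mul_Lproj BL0 !mulmx0 subrr; reflexivity. Qed.

Let F_herm : F^e = F.
Proof. rewrite {1}FE sB !sM sK B0_herm B1_herm FE2; reflexivity. Qed.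

Let C2e : C2^e = C3.
Proof.
rewrite C2E sM s_Rproj B11E sB sM X00_herm B1_herm C3E D11E; reflexivity.
Qed.

(** R_A0 B11 s(A0) = R_A0 F, and F = A0 B1 - B0 s(A1) lies in the column space
    of A0. *)
Let C2q : C2 *m B2 = C2.
Proof.
rewrite C2E B2E (mulmxBr _ 1%:M) mulmx1 -mulmxA (mulmxA B11) B11A mulmxA RF.
rewrite mul0mx subr0; reflexivity.
Qed.

(** R_s(B2) = A0^+ A0, while A0 D11 = F and F L_s(A0) = 0. *)
Lemma RC3 : Rproj B2^e *m C3 = 0.
Proof.
rewrite B2e /Rproj (mpinv_proj (Lproj_idem A0) (qadj_Lproj A0)) Lproj_idem.
rewrite /Lproj opprB addrC subrK C3E -mulmxA (mulmxA A0) AD11 FL mulmx0; reflexivity.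
Qed.

(** The equations for X0 give X0 = X00 + L_A0 U B2. Substituting this into the
    consistency conditions of the pair of equations for X1 yields the system
    for U; the third condition, A0 D = C s(A0), is a commutation condition. *)
Lemma two_sided_param X0 X1 :
  two_sided X0 X1 <->
  exists U U1, [/\ A2 *m U *m B2 = C2, B2^e *m U *m A2^e = C3,
    X0 = gen_std U & X1 = gen_inf U U1].
Proof.
have A1X U : B1 - A1 *m gen_std U = B11 - A11 *m U *m B2.
  rewrite /gen_std mulmxDr opprD addrA B11E A11E !mulmxA; reflexivity.
have XA1 U : B1 - gen_std U *m A1^e = D11 - Lproj A0 *m U *m A11^e.
  rewrite /gen_std mulmxDl opprD addrA A11e D11E !mulmxA; reflexivity.
have RA1X U : Rproj A0 *m (B1 - A1 *m gen_std U) = C2 - A2 *m U *m B2.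
  rewrite A1X mulmxBr C2E A2E !mulmxA; reflexivity.
have XA1L U : (B1 - gen_std U *m A1^e) *m Lproj A0^e = C3 - B2^e *m U *m A2^e.
  rewrite XA1 mulmxBl B2e A2e A11e C3E !mulmxA; reflexivity.
split=> [[e1 e2 e3 e4]|[U [U1 [eC eD -> ->]]]].
  have eX0 : X0 = gen_std X0.
    rewrite {1}(two_sided_general A0 A0^e X0) e1 e2 -X00E -B2E; reflexivity.
  (* A solution serves as its own parameter, by [two_sided_general]. *)
  exists X0, X1; split; last 1 first.
  - rewrite {1}(two_sided_general A0 A0^e X1) e3 e4 {1 2}eX0 A1X XA1 -B2E; reflexivity.
  - apply/eqP; rewrite eq_sym -subr_eq0 -RA1X -eX0 -e3.
    rewrite mulmxA Rproj_mul mul0mx; exact: eqxx.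
  - apply/eqP; rewrite eq_sym -subr_eq0 -XA1L -eX0 -e4.
    rewrite -mulmxA mul_Lproj mulmx0; exact: eqxx.
  - exact: eX0.
have [e1 e2] := two_sided_solution U RB0 BL0 comm.1.
rewrite -X00E -B2E -/(gen_std U) in e1 e2.
have RC : Rproj A0 *m (B11 - A11 *m U *m B2) = 0.
  rewrite -A1X RA1X eC subrr; reflexivity.
have DL : (D11 - Lproj A0 *m U *m A11^e) *m Lproj A0^e = 0.
  rewrite -XA1 XA1L eD subrr; reflexivity.
have ADC : A0 *m (D11 - Lproj A0 *m U *m A11^e) = (B11 - A11 *m U *m B2) *m A0^e.
  by rewrite -XA1 -A1X mulmxBr mulmxBl mulmxA e1 -mulmxA e2; case: comm.
have [] := two_sided_solution U1 RC DL ADC; rewrite -B2E -/(gen_inf U U1) => e3 e4.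
by split; [exact: e1|exact: e2|rewrite A1X|rewrite XA1].
Qed.

Let A2L : A2 *m B2^e = A2.
Proof. rewrite B2e A2E A11E -!mulmxA Lproj_idem; reflexivity. Qed.
Let qA2 : B2 *m A2^e = A2^e.
Proof. rewrite A2e !mulmxA B2E Rproj_idem; reflexivity. Qed.
Let LL : B2^e *m B2^e = B2^e. Proof. rewrite B2e Lproj_idem; reflexivity. Qed.
Let hL : qadj B2^e = B2^e. Proof. rewrite B2e qadj_Lproj; reflexivity. Qed.
Let qq : B2 *m B2 = B2. Proof. rewrite B2E Rproj_idem; reflexivity. Qed.
Let hq : qadj B2 = B2. Proof. rewrite B2E qadj_Rproj; reflexivity. Qed.

Let C3L : Rproj A2 *m C2 = 0 -> C3 *m Lproj A2^e = 0.
Proof. by move=> h; rewrite -C2e -s_Rproj -sM h s0. Qed.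

(** By [qrank_insert] the ranks agree iff A0 Z = B0 and A0 Y + A1 Z = B1 for some
    Y and Z, that is iff R_A0 (B1 - A1 Z) = 0 for some Z = X00 + L_A0 Y'. *)
Lemma rank_R2 :
  qrank (col_mx (row_mx A0 (row_mx B1 A1)) (row_mx (0 : 'M_n) (row_mx B0 A0)))
    = qrank (block_mx A0 A1 0 A0) <-> Rproj A2 *m C2 = 0.
Proof.
have -> : col_mx (row_mx A0 (row_mx B1 A1)) (row_mx 0 (row_mx B0 A0)) =
    row_mx (col_mx A0 0) (row_mx (col_mx B1 B0) (col_mx A1 A0)).
  rewrite -!block_mxEv -!block_mxEh; reflexivity.
rewrite block_mxEh qrank_insert Rproj_range.
split=> [[Y [Z]]|[Y eC]].
  rewrite !mul_col_mx add_col_mx mul0mx add0r => /eq_col_mx[eB1 eB0].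
  exists (Z - B0 *m mpinv A0^e).
  have eZ : Lproj A0 *m Z = Z - mpinv A0 *m B0.
    rewrite /Lproj mulmxBl mul1mx -mulmxA -eB0; reflexivity.
  rewrite C2E B11E A2E A11E -!mulmxA [Lproj A0 *m _]mulmxBr eZ.
  have -> : Rproj A0 *m (B1 - A1 *m X00) = Rproj A0 *m (A1 *m Z - A1 *m X00).
    rewrite eB1 -addrA (mulmxDr (Rproj A0) (A0 *m Y)) (mulmxA _ A0).
    by rewrite Rproj_mul mul0mx add0r.
  rewrite -(addrA Z) -opprD (mulmxA (Lproj A0)) -X00E (mulmxBr A1); reflexivity.
have : Rproj A0 *m (B1 - A1 *m (X00 + Lproj A0 *m Y)) = 0.
  rewrite (mulmxDr A1) opprD addrA -B11E (mulmxBr (Rproj A0)) -C2E eC A2E A11E.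
  by rewrite !mulmxA subrr.
case/Rproj_range => W eW; exists W, (X00 + Lproj A0 *m Y).
rewrite !mul_col_mx add_col_mx mul0mx add0r -eW subrK mulmxDr mulmxA.
rewrite AX00 mul_Lproj mul0mx addr0; reflexivity.
Qed.

(** The added block is -F, and F = A0 B1 - B0 s(A1) lies in the column space
    of A0. *)
Lemma rank_RF : qrank (row_mx A0 (A1 *m B0 - B1 *m A0^e)) = qrank A0.
Proof. by apply/qrank_row_mx; rewrite -opprB mulmxN -FE RF oppr0. Qed.

(** F lies in the column space of A0 and -F = s(-F) in the row space of s(A0), so
    [qrank_bordered] applies. Expanding A2 C3 and C2 s(A2), the terms in F are
    killed by R_A0 or by L_s(A0), and the common term A1 X00 s(A1) cancels in
    the difference. *)
Lemma rank_bordered :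
  qrank (col_mx
      (row_mx (B1 *m A1^e - A1 *m B1) (row_mx A0 (B1 *m A0^e - A1 *m B0)))
      (col_mx
        (row_mx A0^e (row_mx (0 : 'M_n) (0 : 'M_n)))
        (row_mx (B0 *m A1^e - A0 *m B1) (row_mx (0 : 'M_n) (0 : 'M_n)))))
    = (qrank A0 + qrank A0^e)%N <-> A2 *m C3 = C2 *m A2^e.
Proof.
have [f eF] : exists f, F = A0 *m f by apply/Rproj_range.
have -> : B0 *m A1^e - A0 *m B1 = - f^e *m A0^e.
  rewrite mulNmx -sM -eF F_herm FE2 opprB; reflexivity.
rewrite -FE eF qrank_bordered.
have eA : A2 *m C3 =
    Rproj A0 *m (A1 *m B1 - A1 *m X00 *m A1^e) *m Lproj A0^e.
  have LD : Lproj A0 *m D11 = D11 - mpinv A0 *m F.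
    rewrite (mulmxBl 1%:M) mul1mx -mulmxA AD11; reflexivity.
  have -> : A2 *m C3 = Rproj A0 *m (A1 *m (Lproj A0 *m D11 *m Lproj A0^e)).
    rewrite A2E A11E C3E !mulmxA; reflexivity.
  rewrite LD (mulmxBl D11) -(mulmxA (mpinv A0)) FL mulmx0 subr0 !mulmxA.
  rewrite -(mulmxA (Rproj A0)) D11E (mulmxBr A1) (mulmxA A1); reflexivity.
have eC : C2 *m A2^e =
    Rproj A0 *m (B1 *m A1^e - A1 *m X00 *m A1^e) *m Lproj A0^e.
  rewrite A2e !mulmxA C2q C2E -(mulmxA (Rproj A0)) B11E (mulmxBl B1); reflexivity.
have -> : Rproj A0 *m (B1 *m A1^e - A1 *m B1) *m Lproj A0^e
    = C2 *m A2^e - A2 *m C3.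
  have cancel_common (V : zmodType) (x y z : V) : x - z - (y - z) = x - y.
    by rewrite opprB addrA subrK.
  rewrite eA eC -(mulmxBl (Rproj A0 *m _)) -(mulmxBr (Rproj A0)).
  rewrite cancel_common; reflexivity.
split=> [/eqP|->]; last by rewrite subrr.
by rewrite subr_eq0 => /eqP ->.
Qed.

(** A Hermitian solution equals its own symmetrization, so symmetrizing the
    two-sided solutions misses none. *)
Lemma hermitian_solutions X0 X1 :
  [/\ X0^e = X0, X1^e = X1 & solves_parts X0 X1] <->
  exists U U1, [/\ A2 *m U *m B2 = C2, B2^e *m U *m A2^e = C3,
    X0 = symmetrize (gen_std U) & X1 = symmetrize (gen_inf U U1)].
Proof.
split=> [[hX0 hX1 sol]|[U [U1 [eC eD -> ->]]]].
  have /two_sided_param[U [U1 [eC eD eX0 eX1]]] := hermitian_two_sided hX0 hX1 sol.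
  exists U, U1; split; [exact: eC|exact: eD| |].
    rewrite -eX0 /symmetrize hX0 half_double; reflexivity.
  rewrite -eX1 /symmetrize hX1 half_double; reflexivity.
have /symmetrize_solves[sol hX0 hX1] : two_sided (gen_std U) (gen_inf U U1).
  apply/two_sided_param; exists U, U1; split; [exact: eC|exact: eD| |]; reflexivity.
split; [exact: hX0|exact: hX1|exact: sol].
Qed.

Lemma projected_solvable_iff :
  (exists U, A2 *m U *m B2 = C2 /\ B2^e *m U *m A2^e = C3) <->
  [/\ Rproj A2 *m C2 = 0, Rproj B2^e *m C3 = 0 & consistency_residual = 0].
Proof.
split=> [[U [eC eD]]|[RC RD RCD]].
  have C3L0 : C3 *m Lproj A2^e = 0 by rewrite -eD -mulmxA mul_Lproj mulmx0.
  apply/(projected_solvable LL hL A2L qq hq qA2 C2q C3L0).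
  by exists U; split; [exact: eC|exact: eD].
apply/(projected_solvable LL hL A2L qq hq qA2 C2q (C3L RC)).
by split; [exact: RC|exact: RD|exact: RCD].
Qed.

Lemma residual_rank : Rproj A2 *m C2 = 0 ->
  (consistency_residual = 0 <-> qrank (col_mx
      (row_mx (B1 *m A1^e - A1 *m B1) (row_mx A0 (B1 *m A0^e - A1 *m B0)))
      (col_mx
        (row_mx A0^e (row_mx (0 : 'M_n) (0 : 'M_n)))
        (row_mx (B0 *m A1^e - A0 *m B1) (row_mx (0 : 'M_n) (0 : 'M_n)))))
    = (qrank A0 + qrank A0^e)%N).
Proof.
move=> RC; rewrite rank_bordered.
exact: (projected_consistency LL hL A2L qq hq qA2 RC RC3).
Qed.

Lemma general_hermitian_solution :
    (exists U, A2 *m U *m B2 = C2 /\ B2^e *m U *m A2^e = C3) ->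
  forall X0 X1, [/\ X0^e = X0, X1^e = X1 & solves_parts X0 X1] <->
  exists U1 U2 U3 U4 U5 : 'M_n,
    let U := proj_Phi B2^e A2 B2 A2^e C2 C3
      + Lproj A2 *m Lproj (proj_A00 B2^e A2) *m U2
      + U3 *m Rproj (proj_B00 B2 A2^e) *m Rproj B2
      + Lproj A2 *m U4 *m Rproj A2^e + Lproj B2^e *m U5 *m Rproj B2 in
    X0 = symmetrize (gen_std U) /\ X1 = symmetrize (gen_inf U U1).
Proof.
move=> solv X0 X1.
have C3L0 : C3 *m Lproj A2^e = 0.
  by case: solv => U [_ <-]; rewrite -mulmxA mul_Lproj mulmx0.
have gen U := projected_general LL hL A2L qq hq qA2 C2q C3L0 U solv.
rewrite hermitian_solutions; split=> [[U [U1 [eC eD eX0 eX1]]]|].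
  have /gen[U2 [U3 [U4 [U5 eU]]]] : A2 *m U *m B2 = C2 /\ B2^e *m U *m A2^e = C3.
    by split; [exact: eC|exact: eD].
  exists U1, U2, U3, U4, U5; rewrite /= -eU.
  by split; [exact: eX0|exact: eX1].
move=> [U1 [U2 [U3 [U4 [U5 /=]]]]]; set U := (_ + Lproj B2^e *m _ *m _) => -[eX0 eX1].
have [eC eD] : A2 *m U *m B2 = C2 /\ B2^e *m U *m A2^e = C3.
  by apply/gen; exists U2, U3, U4, U5.
by exists U, U1; split; [exact: eC|exact: eD|exact: eX0|exact: eX1].
Qed.

End Compatible.

Definition projection_criterion := commutation /\
  [/\ Rproj A0 *m B0 = 0, Rproj A2 *m C2 = 0, Rproj B2^e *m C3 = 0
    & consistency_residual = 0].

Lemma solvable_projection :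
  (exists X0 X1, [/\ X0^e = X0, X1^e = X1 & solves_parts X0 X1]) <->
  projection_criterion.
Proof.
split=> [[X0 [X1 [hX0 hX1 sol]]]|[comm [RB0 RC RD res0]]].
  have comm := two_sided_commutation (hermitian_two_sided hX0 hX1 sol).
  have RB0 : Rproj A0 *m B0 = 0 by rewrite -(proj1 sol) mulmxA Rproj_mul mul0mx.
  have /(hermitian_solutions comm RB0)[U [U1 [eC eD _ _]]] :
    [/\ X0^e = X0, X1^e = X1 & solves_parts X0 X1]
    by split; [exact: hX0|exact: hX1|exact: sol].
  have /(projected_solvable_iff comm RB0)[RC RD res0] :
      exists U, A2 *m U *m B2 = C2 /\ B2^e *m U *m A2^e = C3.
    by exists U; split; [exact: eC|exact: eD].
  by split; [exact: comm|split; [exact: RB0|exact: RC|exact: RD|exact: res0]].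
have /(projected_solvable_iff comm RB0)[U [eC eD]] :
    [/\ Rproj A2 *m C2 = 0, Rproj B2^e *m C3 = 0 & consistency_residual = 0].
  by split; [exact: RC|exact: RD|exact: res0].
exists (symmetrize (gen_std U)), (symmetrize (gen_inf U 0)).
apply/(hermitian_solutions comm RB0).
exists U, 0; split; [exact: eC|exact: eD| |]; reflexivity.
Qed.

Lemma projection_rank :
  projection_criterion <-> commutation /\
  [/\ qrank (row_mx A0 B0) = qrank A0,
      qrank (col_mx (row_mx A0 (row_mx B1 A1))
                    (row_mx (0 : 'M_n) (row_mx B0 A0)))
        = qrank (block_mx A0 A1 0 A0),
      qrank (row_mx A0 (A1 *m B0 - B1 *m A0^e)) = qrank A0
    & qrank (col_mx
        (row_mx (B1 *m A1^e - A1 *m B1) (row_mx A0 (B1 *m A0^e - A1 *m B0)))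
        (col_mx
          (row_mx A0^e (row_mx (0 : 'M_n) (0 : 'M_n)))
          (row_mx (B0 *m A1^e - A0 *m B1) (row_mx (0 : 'M_n) (0 : 'M_n)))))
      = (qrank A0 + qrank A0^e)%N].
Proof.
split=> [[comm [RB0 RC RD res0]]|[comm [/qrank_row_mx RB0 r2 _ r4]]].
  split; first exact: comm.
  split; first exact/qrank_row_mx.
  - exact/(rank_R2 comm RB0).
  - exact: (rank_RF comm RB0).
  - exact/(residual_rank comm RB0 RC).
have RC := (rank_R2 comm RB0).1 r2.
split; [exact: comm|split; [exact: RB0|exact: RC|exact: (RC3 comm RB0)|]].
exact/(residual_rank comm RB0 RC).
Qed.

End CoefficientEquations.

(** * Standard and infinitesimal parts *)

Section DualParts.
Variable R : realType.

Lemma dualmx_inj m n (A B : 'M[dquat R]_(m, n)) :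
  stdmx A = stdmx B -> infmx A = infmx B -> A = B.
Proof. by move=> e0 e1; rewrite -[A]dualmxK -[B]dualmxK e0 e1. Qed.

Lemma stdmx_dualmx m n (M N : 'M[quat R]_(m, n)) : stdmx (dualmx M N) = M.
Proof. by apply/matrixP => i j; rewrite !mxE. Qed.

Lemma infmx_dualmx m n (M N : 'M[quat R]_(m, n)) : infmx (dualmx M N) = N.
Proof. by apply/matrixP => i j; rewrite !mxE. Qed.

Lemma stdmxM m n p (A : 'M[dquat R]_(m, n)) (B : 'M_(n, p)) :
  stdmx (A *m B) = stdmx A *m stdmx B.
Proof.
apply/matrixP => i j; rewrite !mxE (big_morph (@d_std _) (fun _ _ => erefl) erefl).
by apply: eq_bigr => k _; rewrite !mxE.
Qed.

Lemma infmxM m n p (A : 'M[dquat R]_(m, n)) (B : 'M_(n, p)) :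
  infmx (A *m B) = stdmx A *m infmx B + infmx A *m stdmx B.
Proof.
apply/matrixP => i j; rewrite !mxE (big_morph (@d_inf _) (fun _ _ => erefl) erefl).
by rewrite -big_split; apply: eq_bigr => k _; rewrite !mxE.
Qed.

Lemma stdmxN m n (A : 'M[dquat R]_(m, n)) : stdmx (- A) = - stdmx A.
Proof. by apply/matrixP => i j; rewrite !mxE. Qed.

Lemma infmxN m n (A : 'M[dquat R]_(m, n)) : infmx (- A) = - infmx A.
Proof. by apply/matrixP => i j; rewrite !mxE. Qed.

Lemma stdmx_scalar n (a : quat R) : stdmx ((Dual a 0)%:M : 'M_n) = a%:M.
Proof. by apply/matrixP => i j; rewrite !mxE; case: (i == j). Qed.

Lemma infmx_scalar n (a : quat R) : infmx ((Dual a 0)%:M : 'M_n) = 0.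
Proof. by apply/matrixP => i j; rewrite !mxE; case: (i == j). Qed.

Lemma stdmx_dqadj m n (A : 'M[dquat R]_(m, n)) : stdmx (dqadj A) = qadj (stdmx A).
Proof. by apply/matrixP => i j; rewrite !mxE. Qed.

Lemma infmx_dqadj m n (A : 'M[dquat R]_(m, n)) : infmx (dqadj A) = qadj (infmx A).
Proof. by apply/matrixP => i j; rewrite !mxE. Qed.

Lemma stdmx_detaadj eta m n (A : 'M[dquat R]_(m, n)) :
  stdmx (detaadj eta A) = etaadj eta (stdmx A).
Proof. by rewrite /detaadj stdmxN !stdmxM !stdmx_scalar stdmx_dqadj. Qed.

Lemma infmx_detaadj eta m n (A : 'M[dquat R]_(m, n)) :
  infmx (detaadj eta A) = etaadj eta (infmx A).
Proof.
rewrite /detaadj infmxN infmxM stdmxM infmxM !stdmx_scalar !infmx_scalar.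
by rewrite mulmx0 mul0mx addr0 add0r infmx_dqadj.
Qed.

Lemma dual_hermitian_solution eta n (A B X : 'M[dquat R]_n) :
  A *m X = B /\ eta_hermitian eta X <->
  [/\ etaadj eta (stdmx X) = stdmx X, etaadj eta (infmx X) = infmx X
    & solves_parts (stdmx A) (infmx A) (stdmx B) (infmx B) (stdmx X) (infmx X)].
Proof.
rewrite /eta_hermitian; split=> [[<- hX]|[h0 h1 [e0 e1]]].
  rewrite -stdmx_detaadj -infmx_detaadj -hX; split=> //.
  by rewrite /solves_parts stdmxM infmxM.
split; apply: dualmx_inj.
- by rewrite stdmxM.
- by rewrite infmxM.
- by rewrite stdmx_detaadj.
- by rewrite infmx_detaadj.
Qed.

End DualParts.

Theorem corollary3p5 (R : realType) (n : nat) (eta : quat R)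
    (A B : 'M[dquat R]_n)
    (eta_unit : eta \in [:: quatI R; quatJ R; quatK R])
    (B_herm : detaadj eta B = B) :
  let A0 := stdmx A in let A1 := infmx A in
  let B0 := stdmx B in let B1 := infmx B in
  let A0e := etaadj eta A0 in let A1e := etaadj eta A1 in
  let B11 := B1 - A1 *m (mpinv A0 *m B0 + Lproj A0 *m B0 *m mpinv A0e) in
  let D11 := B1 - (mpinv A0 *m B0 + Lproj A0 *m B0 *m mpinv A0e) *m A1e in
  let A11 := A1 *m Lproj A0 in
  let A2 := Rproj A0 *m A11 in
  let B2 := Rproj A0e in
  let C2 := Rproj A0 *m B11 in
  let C3 := D11 *m Lproj A0e in
  let A11e := etaadj eta A11 in
  let A2e := etaadj eta A2 in let B2e := etaadj eta B2 in
  let A00 := B2e *m Lproj A2 in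
  let B00 := Rproj B2 *m A2e in
  let C00 := C3 - B2e *m mpinv A2 *m C2 *m mpinv B2 *m A2e in
  let D00 := Rproj A00 *m B2e in
  let Phi :=
    mpinv A2 *m C2 *m mpinv B2
    + Lproj A2 *m mpinv A00 *m C00 *m mpinv A2e
    - Lproj A2 *m mpinv A00 *m B2e *m mpinv D00 *m Rproj A00 *m C00
        *m mpinv A2e
    + mpinv D00 *m Rproj A00 *m C00 *m mpinv B00 *m Rproj B2 in
  let compatible :=
    A0 *m B0 = B0 *m A0e /\
    A0 *m B1 - B0 *m A1e = B1 *m A0e - A1 *m B0 in
  let solvable :=
    exists X : 'M[dquat R]_n, A *m X = B /\ eta_hermitian eta X in
  let projection_conditions :=
    compatible /\
    [/\ Rproj A0 *m B0 = 0, Rproj A2 *m C2 = 0, Rproj B2e *m C3 = 0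
      & Rproj A00 *m C00 *m Lproj B00 = 0] in
  let rank_conditions :=
    compatible /\
    [/\ qrank (row_mx A0 B0) = qrank A0,
        qrank (col_mx (row_mx A0 (row_mx B1 A1))
                      (row_mx (0 : 'M_n) (row_mx B0 A0)))
          = qrank (block_mx A0 A1 0 A0),
        qrank (row_mx A0 (A1 *m B0 - B1 *m A0e)) = qrank A0,
        qrank (col_mx
            (row_mx (B1 *m A1e - A1 *m B1)
                    (row_mx A0 (B1 *m A0e - A1 *m B0)))
            (col_mx
              (row_mx A0e (row_mx (0 : 'M_n) (0 : 'M_n)))
              (row_mx (B0 *m A1e - A0 *m B1)
                      (row_mx (0 : 'M_n) (0 : 'M_n)))))
          = (qrank A0 + qrank A0e)%N
      & (qrank A0 + qrank A0e = 2 * qrank A0)%N] in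
  let X0t U :=
    mpinv A0 *m B0 + Lproj A0 *m B0 *m mpinv A0e
    + Lproj A0 *m U *m Rproj A0e in
  let X1t U U1 :=
    mpinv A0 *m (B11 - A11 *m U *m Rproj A0e)
    + Lproj A0 *m (D11 - Lproj A0 *m U *m A11e) *m mpinv A0e
    + Lproj A0 *m U1 *m Rproj A0e in
  let gen_U U2 U3 U4 U5 :=
    Phi + Lproj A2 *m Lproj A00 *m U2 + U3 *m Rproj B00 *m Rproj B2
    + Lproj A2 *m U4 *m Rproj A2e + Lproj B2e *m U5 *m Rproj B2 in
  let eta_sym (M : 'M[quat R]_n) := (2%:R : quat R)^-1 *: (M + etaadj eta M) in
  [<-> solvable; projection_conditions; rank_conditions] /\
  (solvable ->
   forall X : 'M[dquat R]_n,
     A *m X = B /\ eta_hermitian eta X <->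
     exists U1 U2 U3 U4 U5 : 'M[quat R]_n,
       let U := gen_U U2 U3 U4 U5 in
       X = dualmx (eta_sym (X0t U)) (eta_sym (X1t U U1))).
Proof.
move=> A0 A1 B0 B1 A0e A1e B11 D11 A11 A2 B2 C2 C3 A11e A2e B2e A00 B00 C00 D00 Phi.
move=> compatible solvable projection_conditions rank_conditions X0t X1t gen_U eta_sym.
have sK := @etaadjK R eta eta_unit n n.
have sB := @etaadjB R eta n n.
have sM := @etaadjM R eta eta_unit n n n.
have s_mpinv := @mpinv_etaadj R eta eta_unit n n.
have hB0 : etaadj eta B0 = B0 by rewrite -stdmx_detaadj B_herm.
have hB1 : etaadj eta B1 = B1 by rewrite -infmx_detaadj B_herm.
pose X00 := mpinv A0 *m B0 + Lproj A0 *m B0 *m mpinv A0e.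
pose F := B1 *m A0e - A1 *m B0.
have dualP : solvable <-> exists X0 X1 : 'M_n,
    [/\ etaadj eta X0 = X0, etaadj eta X1 = X1 & solves_parts A0 A1 B0 B1 X0 X1].
  split=> [[X /dual_hermitian_solution[h0 h1 sol]]|[X0 [X1 [h0 h1 sol]]]].
    by exists (stdmx X), (infmx X); split; [exact: h0|exact: h1|exact: sol].
  exists (dualmx X0 X1); apply/dual_hermitian_solution.
  rewrite stdmx_dualmx infmx_dualmx.
  by split; [exact: h0|exact: h1|exact: sol].
have solP : solvable <-> projection_conditions.
  have h := @solvable_projection R n (@etaadj R eta n n) sK sB sM s_mpinv
    A0 A1 B0 B1 hB0 hB1 X00 B11 D11 A11 A2 C2 C3 B2 F
    erefl erefl erefl erefl erefl erefl erefl erefl erefl.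
  by split=> [/dualP/h|/h/dualP].
have rankP := @projection_rank R n (@etaadj R eta n n) sK sB sM s_mpinv
    A0 A1 B0 B1 hB0 hB1 X00 B11 D11 A11 A2 C2 C3 B2 F
    erefl erefl erefl erefl erefl erefl erefl erefl erefl.
split.
  tfae.
  - by move/solP.
  - move/rankP => [comm [r1 r2 r3 r4]]; split; first exact: comm.
    split; [exact: r1|exact: r2|exact: r3|exact: r4|].
    by rewrite qrank_etaadj // mul2n addnn.
  - move=> [comm [r1 r2 r3 r4 _]]; apply/solP/rankP.
    by split; [exact: comm|split; [exact: r1|exact: r2|exact: r3|exact: r4]].
move=> solv X; have [comm [RB0 RC RD res0]] := solP.1 solv.
have solvU := (@projected_solvable_iff R n (@etaadj R eta n n) sK sB sM s_mpinv
    A0 A1 B0 B1 hB0 hB1 X00 B11 D11 A11 A2 C2 C3 B2 F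
    erefl erefl erefl erefl erefl erefl erefl erefl erefl comm RB0).2
  (And3 RC RD res0).
have gen := @general_hermitian_solution R n (@etaadj R eta n n) sK sB sM s_mpinv
    A0 A1 B0 B1 hB0 hB1 X00 B11 D11 A11 A2 C2 C3 B2 F
    erefl erefl erefl erefl erefl erefl erefl erefl erefl comm RB0 solvU
    (stdmx X) (infmx X).
apply: iff_trans (dual_hermitian_solution eta A B X) _.
apply: iff_trans gen _; split=> -[U1 [U2 [U3 [U4 [U5 h]]]]].
  exists U1, U2, U3, U4, U5; case: h => h0 h1.
  by rewrite -[X]dualmxK h0 h1.
exists U1, U2, U3, U4, U5; rewrite h stdmx_dualmx infmx_dualmx.
by split; reflexivity.
Qed.
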